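(* Let $N\ge 2$ and let $p,q$ be real exponents. There exist non-constant radial positive solutions of $$-\Delta u=u^p|\nabla u|^q\quad\text{in }\mathbb{R}^N$$ if and only if $p\ge 0$, $0\le q<1$ and $$p(N-2)+q(N-1)\ge N+\frac{2-q}{1-q}.$$ Moreover, if $p\ge 0$, $0\le q<1$ and equality holds in the last inequality, then there is an explicit one-parameter family of positive radial solutions in $\mathbb{R}^N$: there exists a constant $K=K(N,q)>0$ such that for every $c>0$ the function $$u_c(r)=c\left(Kc^{\frac{(2-q)^2}{(N-2)(1-q)}}+r^{\frac{2-q}{1-q}}\right)^{-\frac{(N-2)(1-q)}{2-q}},\qquad r=|x|,$$ is a solution.
   Context: Solutions are classical, i.e. of class $C^2(\mathbb{R}^N)$. A solution is radial if it is radially symmetric with respect to some point, taken to be the origin up to translation, so that $u=u(r)$ with $r=|x|$. (For $N=2$ equality in the condition never occurs.) *)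

(* Defs.v *)
From HB Require Import structures.
From mathcomp Require Import all_boot all_order all_algebra.
From mathcomp Require Import all_classical all_reals all_analysis.

Set Implicit Arguments.
Unset Strict Implicit.
Unset Printing Implicit Defensive.

Import Order.TTheory GRing.Theory Num.Theory.
Import numFieldNormedType.Exports.

Local Open Scope ring_scope.

Section Euclidean.
Context {R : realType} {N : nat}.
Implicit Types (u : 'rV[R]_N -> R) (x : 'rV[R]_N).

(* `|x| on 'rV[R]_N is the sup norm, which induces the same topology. *)
Definition enorm x : R := Num.sqrt (\sum_(i < N) x ord0 i ^+ 2).

Fixpoint class_C (k : nat) u : Prop :=
  if k is k'.+1 then
    continuous u /\
    forall i : 'I_N, (forall x, derivable u x 'e_i) /\
                     class_C k' (fun x => 'D_'e_i u x)
  else continuous u.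

Definition gradient u x : 'rV[R]_N := \row_(i < N) 'D_'e_i u x.

Definition laplacian u x : R :=
  \sum_(i < N) 'D_'e_i (fun y => 'D_'e_i u y) x.

(* Powers are powR: 0 `^ 0 = 1, so for q = 0 the equation is
   - laplacian u = u `^ p everywhere, critical points included.
   For q < 0 powR sets 0 `^ q = 0, so the equation reads laplacian u x = 0 at a
   critical point, where the right-hand side is mathematically undefined; this
   admits at least all the functions obtained by forbidding critical points. *)
Definition positive_solution (p q : R) u : Prop :=
  [/\ class_C 2 u,
      forall x, 0 < u x &
      forall x, - laplacian u x = u x `^ p * enorm (gradient u x) `^ q].

Definition radial_about (x0 : 'rV[R]_N) u : Prop :=
  exists v : R -> R, forall x, u x = v (enorm (x - x0)).

Definition radial u : Prop := exists x0, radial_about x0 u.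

Definition non_constant u : Prop := ~ exists c : R, forall x, u x = c.

End Euclidean.

(* Main.v *)
Require Import Defs.
From HB Require Import structures.
From mathcomp Require Import all_boot all_order all_algebra.
From mathcomp Require Import all_classical all_reals all_analysis.
From mathcomp Require Import ring lra.

Set Implicit Arguments.
Unset Strict Implicit.
Unset Printing Implicit Defensive.

Import Order.TTheory GRing.Theory Num.Theory.
Import numFieldNormedType.Exports.

Local Open Scope ring_scope.
Local Open Scope classical_set_scope.

(** A radial function u(x) = f(|x|) with slope w = - f' solves the equation
    away from the origin if and only if w' = f^p |w|^q - n w / r, n = N - 1.
    Put e = 1 - q. Where w > 0 and e > 0 the flux A = r^(n e) w^e satisfies
      A' = e r^(n e) f^p,
    which is the radial Emden-Fowler equation of the m-Laplacian with
    m = 1 + e = 2 - q in the (fractional) dimension d = n e + 1. The condition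
    of the theorem says that p is at least the critical Sobolev exponent of
    that equation, that is d / (p + 1) <= (d - m) / m (critical_conditionE).
    Everything rests on the Pohozaev function P, whose derivative is
    e (d / (p + 1) - (d - m) / m) r^(n e) f^(p + 1) (pohozaev_deriv), and on
    the two ways in which it interacts with the inequality
    r w <= (n - 1) f, which says that r^(N - 2) f is nondecreasing.

    Necessity. Since w^q is not Lipschitz for 0 < q < 1, a solution may be
    constant on a ball before it starts to decrease; all arguments start at
    the radius r0 where the slope becomes positive. There q < 0 would make
    the Laplacian blow up and q >= 1 would force w = 0 by a Gronwall argument,
    so that 0 <= q < 1. Superharmonicity makes (n - 1) f - r w nonincreasing,
    and it must stay nonnegative, for otherwise f would tend to - oo like a
    logarithm (slope_le_profile). Integrating the law of the flux bounds w
    from below, hence f from above: r^(1 + e) f^p <= C f^e (profile_upper).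
    This excludes p < 0. In the subcritical case P is increasing from a
    nonnegative value, while r w <= (n - 1) f leaves only its term in
    r^d f^(p + 1); the resulting lower bound on f contradicts the upper one
    (no_subcritical_profile).

    Sufficiency. The integral form of the flux law, with f in the source
    truncated between an explicit positive barrier and 1, is a Volterra
    equation with locally Lipschitz data, and has a global solution
    (picard_fixpoint). As long as the solution is above the barrier, P is
    nonincreasing from 0, hence P <= 0, hence r w <= (n - 1) f; so
    r^(N - 2) f does not decrease and f cannot reach the barrier, which decays
    at the same rate with a smaller constant (above_barrier). The truncation
    is thus never active. When the derivative of P vanishes identically, the
    equation has the explicit solutions of the theorem, which are checked by
    differentiation (bubble_solution).

    Smoothness at the origin comes from a criterion for radial functions:
    if f' = r phi and phi' = psi / r with phi and psi continuous up to 0 and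
    psi 0 = 0, then f(|x|) is of class C2, with gradient phi(|x|) x and
    Laplacian N phi + psi (radial_class_C2, laplacian_radial). *)

(** * Differentiation of real functions *)

Section Calculus.
Context {R : realType}.
Implicit Types (f g h : R -> R) (a b c x y r t d df dg : R).

(** A synonym that is not a type class: the rules below are then applied by
    hand, and the form of the derivative is the one that they produce. *)
Definition has_deriv f x d := is_derive x 1 f d.

Lemma has_deriv_eq f x d d' : has_deriv f x d -> d = d' -> has_deriv f x d'.
Proof. by move=> + <-. Qed.

Lemma has_deriv_cst c x : has_deriv (fun _ : R => c) x 0.
Proof. exact: is_derive_cst. Qed.

Lemma has_deriv_id x : has_deriv (fun t : R => t) x 1.
Proof. exact: is_derive_id. Qed.

Lemma has_derivD f g x df dg : has_deriv f x df -> has_deriv g x dg ->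
  has_deriv (fun t => f t + g t) x (df + dg).
Proof. by move=> Hf Hg; exact: is_deriveD. Qed.

Lemma has_derivN f x df : has_deriv f x df ->
  has_deriv (fun t => - f t) x (- df).
Proof. by move=> Hf; exact: is_deriveN. Qed.

Lemma has_derivM f g x df dg : has_deriv f x df -> has_deriv g x dg ->
  has_deriv (fun t => f t * g t) x (df * g x + f x * dg).
Proof.
move=> Hf Hg; apply: (@is_derive_eq _ _ _ _ _ _ _ _ (is_deriveM Hf Hg)).
by rewrite /GRing.scale /=; ring.
Qed.

Lemma has_derivB f g x df dg : has_deriv f x df -> has_deriv g x dg ->
  has_deriv (fun t => f t - g t) x (df - dg).
Proof. by move=> Hf Hg; apply: has_derivD => //; apply: has_derivN. Qed.

Lemma has_derivZ c f x df : has_deriv f x df ->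
  has_deriv (fun t => c * f t) x (c * df).
Proof.
move=> Hf; apply: has_deriv_eq; first exact: has_derivM (has_deriv_cst c x) Hf.
by rewrite mul0r add0r.
Qed.

Lemma has_deriv_comp f g x df dg : has_deriv f (g x) df ->
  has_deriv g x dg -> has_deriv (fun t => f (g t)) x (df * dg).
Proof. by move=> Hf Hg; exact: is_derive1_comp. Qed.

Lemma has_deriv_powR f a x df : 0 < f x -> has_deriv f x df ->
  has_deriv (fun t => f t `^ a) x (a * f x `^ (a - 1) * df).
Proof.
move=> f0 Hf.
have H := is_derive1_powR a f0.
by have := has_deriv_comp H Hf.
Qed.

Lemma has_derivV f x df : f x != 0 -> has_deriv f x df ->
  has_deriv (fun t => (f t)^-1) x (- df / f x ^+ 2).
Proof.
move=> f0 Hf; apply: (@is_derive_eq _ _ _ _ _ _ _ _ (is_deriveV f0 Hf)).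
by rewrite /GRing.scale /=; field.
Qed.

Lemma has_derivX f x df n : has_deriv f x df ->
  has_deriv (fun t => f t ^+ n) x (n%:R * f x ^+ n.-1 * df).
Proof.
move=> Hf.
have -> : (fun t => f t ^+ n) = f ^+ n by rewrite exprfctE.
apply: (@is_derive_eq _ _ _ _ _ _ _ _ (is_deriveX n Hf)).
by rewrite /GRing.scale /= -mulr_natl.
Qed.

Lemma has_deriv_expR f x df : has_deriv f x df ->
  has_deriv (fun t => expR (f t)) x (expR (f x) * df).
Proof. by move=> Hf; exact: (@has_deriv_comp expR f x _ _ (is_derive_expR _) Hf). Qed.

Lemma has_deriv_ln f x df : 0 < f x -> has_deriv f x df ->
  has_deriv (fun t => ln (f t)) x (df / f x).
Proof.
move=> f0 Hf.
apply: (@is_derive_eq _ _ _ _ _ _ _ _ (@has_deriv_comp (@ln R) f x _ _ (is_derive1_ln f0) Hf)).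
by rewrite mulrC.
Qed.

Lemma has_deriv_sqrt f x df : 0 < f x -> has_deriv f x df ->
  has_deriv (fun t => Num.sqrt (f t)) x (df / (2 * Num.sqrt (f x))).
Proof.
move=> f0 Hf.
apply: (@is_derive_eq _ _ _ _ _ _ _ _ (@has_deriv_comp (@Num.sqrt R) f x _ _ (is_derive1_sqrt f0) Hf)).
by rewrite mulrC.
Qed.

Lemma has_deriv_continuous f x df : has_deriv f x df -> {for x, continuous f}.
Proof.
by case=> Hf _; apply: differentiable_continuous; exact/derivable1_diffP.
Qed.

Lemma has_deriv_unique f x d d' : has_deriv f x d -> has_deriv f x d' -> d = d'.
Proof. by move=> [_ <-] [_ <-]. Qed.

Lemma has_deriv_near f g x df e : 0 < e ->
  (forall t, `|t - x| < e -> f t = g t) -> has_deriv f x df ->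
  has_deriv g x df.
Proof.
move=> e0 Hfg; apply: near_eq_is_derive.
near=> t; apply: Hfg; near: t.
exists e => //= t /=; rewrite distrC; exact.
Unshelve. all: by end_near. Qed.

(** Profiles are only meaningful for positive radii; this discards absolute
    values and conventions at the other arguments. *)
Lemma has_deriv_gt0_eq f g x df : 0 < x ->
  (forall t, 0 < t -> f t = g t) -> has_deriv f x df -> has_deriv g x df.
Proof.
move=> x0 Hfg; apply: (has_deriv_near x0) => t.
by rewrite ltr_norml => /andP[H _]; apply: Hfg; lra.
Qed.

Lemma deriv_ndecr f (df : R -> R) a b : a <= b ->
  (forall x, a <= x <= b -> {for x, continuous f}) ->
  (forall x, a < x < b -> has_deriv f x (df x)) ->
  (forall x, a < x < b -> 0 <= df x) -> f a <= f b.
Proof.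
rewrite le_eqVlt => /predU1P[->//|ab] fc fd df0.
have fc' : {within `[a, b], continuous f}.
  by apply: continuous_in_subspaceT => x; rewrite inE /= in_itv => /fc.
have fd' x : x \in `]a, b[%R -> has_deriv f x (df x) by rewrite in_itv; exact: fd.
have [c + E] := MVT ab fd' fc'.
rewrite in_itv => /df0 dc0; rewrite -subr_ge0 E mulr_ge0 // subr_ge0; exact: ltW.
Qed.

Lemma deriv_incr f (df : R -> R) a b : a < b ->
  (forall x, a <= x <= b -> {for x, continuous f}) ->
  (forall x, a < x < b -> has_deriv f x (df x)) ->
  (forall x, a < x < b -> 0 < df x) -> f a < f b.
Proof.
move=> ab fc fd df0.
have fc' : {within `[a, b], continuous f}.
  by apply: continuous_in_subspaceT => x; rewrite inE /= in_itv => /fc.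
have fd' x : x \in `]a, b[%R -> has_deriv f x (df x) by rewrite in_itv; exact: fd.
have [c + E] := MVT ab fd' fc'.
by rewrite in_itv => /df0 dc0; rewrite -subr_gt0 E mulr_gt0 // subr_gt0.
Qed.

Lemma deriv_norm_le f (df : R -> R) g (dg : R -> R) a b : a <= b ->
  (forall x, a <= x <= b -> {for x, continuous f}) ->
  (forall x, a <= x <= b -> {for x, continuous g}) ->
  (forall x, a < x < b -> has_deriv f x (df x)) ->
  (forall x, a < x < b -> has_deriv g x (dg x)) ->
  (forall x, a < x < b -> `|df x| <= dg x) -> `|f b - f a| <= g b - g a.
Proof.
move=> ab fc gc fd gd dfg; rewrite ler_norml; apply/andP; split.
- suff : f a + g a <= f b + g b by lra.
  apply: (@deriv_ndecr (fun t => f t + g t) (fun t => df t + dg t)) => // x Hx.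
  + by apply: continuousD; [exact: fc|exact: gc].
  + by apply: has_derivD; [exact: fd|exact: gd].
  + by have := dfg x Hx; rewrite ler_norml => /andP[H _]; lra.
- suff : g a - f a <= g b - f b by lra.
  apply: (@deriv_ndecr (fun t => g t - f t) (fun t => dg t - df t)) => // x Hx.
  + by apply: continuousB; [exact: gc|exact: fc].
  + by apply: has_derivD; [exact: gd|apply: has_derivN; exact: fd].
  + by have := dfg x Hx; rewrite ler_norml => /andP[_ H]; lra.
Qed.

Lemma right_limit_ge (g : R -> R) (c x y : R) : x < y ->
  {for x, continuous g} -> (forall t, x < t < y -> c <= g t) -> c <= g x.
Proof.
move=> xy gc H.
have gr : g t @[t --> x^'+] --> g x by exact: cvg_at_right_filter.
apply: (cvgr_to_ge gr); near=> t; apply: H; apply/andP; split.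
- near: t; exact: nbhs_right_gt.
- near: t; exact: nbhs_right_lt.
Unshelve. all: by end_near. Qed.

Section Continuity.
Context {T : topologicalType}.
Implicit Types (u v : T -> R) (z : T).

(** The rules of continuity for functions given by their values, as opposed
    to sums and products in a ring of functions. *)
Lemma continuous_add u v z : {for z, continuous u} -> {for z, continuous v} ->
  {for z, continuous (fun s => u s + v s)}.
Proof. by move=> uc vc; exact: (continuousD uc vc). Qed.

Lemma continuous_opp u z : {for z, continuous u} ->
  {for z, continuous (fun s => - u s)}.
Proof. by move=> uc; exact: (continuousN uc). Qed.

Lemma continuous_mul u v z : {for z, continuous u} -> {for z, continuous v} ->
  {for z, continuous (fun s => u s * v s)}.
Proof. by move=> uc vc; exact: (continuousM uc vc). Qed.

Lemma continuous_inv u z : u z != 0 -> {for z, continuous u} ->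
  {for z, continuous (fun s => (u s)^-1)}.
Proof. by move=> u0 uc; exact: (continuousV u0 uc). Qed.

Lemma continuous_expn u n z : {for z, continuous u} ->
  {for z, continuous (fun s => u s ^+ n)}.
Proof.
move=> uc; apply: (@continuous_comp _ _ _ u (fun w : R => w ^+ n)) => //.
exact: exprn_continuous.
Qed.

Lemma continuous_cstE c z : {for z, continuous (fun _ : T => c)}.
Proof. exact: cvg_cst. Qed.

End Continuity.

End Calculus.

(** * Real powers *)

Section RealPowers.
Context {R : realType}.
Implicit Types (f : R -> R) (a b c x y s t : R).

Lemma powRD1 (x a : R) : 0 < x -> x `^ (a + 1) = x `^ a * x.
Proof.
by move=> x0; rewrite powRD ?powRr1 ?ltW // (gt_eqF x0) implybT.
Qed.

Lemma powRB1 (x a : R) : 0 < x -> x `^ (a - 1) = x `^ a / x.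
Proof. by move=> x0; rewrite -[in RHS](subrK 1 a) powRD1 // mulfK // gt_eqF. Qed.

Lemma powR_ndecr (a x y : R) : 0 <= a -> 0 <= x -> x <= y -> x `^ a <= y `^ a.
Proof.
by move=> a0 x0 xy; apply: ge0_ler_powR; rewrite ?nnegrE // (le_trans x0).
Qed.

Lemma powR_nincr (a x y : R) : a <= 0 -> 0 < x -> x <= y -> y `^ a <= x `^ a.
Proof.
move=> a0 x0 xy; rewrite -[a]opprK ![_ `^ (- - a)]powRN.
rewrite lef_pV2 ?posrE ?powR_gt0 ?(lt_le_trans x0) //.
by apply: powR_ndecr; rewrite ?oppr_ge0 // ltW.
Qed.

(** Contradictions at infinity are obtained by comparing a bounded quantity with a
    positive power of the radius. *)
Lemma powR_unbounded (a c C s : R) : 0 < a -> 0 < c ->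
  exists2 r, s <= r & C < c * r `^ a.
Proof.
move=> a0 c0; pose M := Num.max C 1 / c.
have M0 : 0 < M by rewrite divr_gt0 // lt_max ltr01 orbT.
pose r := Num.max s (1 + M `^ a^-1).
have Mr : M `^ a^-1 < r by rewrite lt_max ltrDr ltr01 orbT.
exists r; first by rewrite le_max lexx.
have : M < r `^ a.
  rewrite -[M](powRr1 (ltW M0)) -[1](mulVf (lt0r_neq0 a0)) powRrM.
  by apply: gt0_ltr_powR => //; rewrite nnegrE ?powR_ge0 // ltW // (le_lt_trans _ Mr) // powR_ge0.
rewrite ltr_pdivrMr // mulrC => H.
by apply: le_lt_trans H; rewrite le_max lexx.
Qed.

(** The absolute value removes the convention at negative arguments, where
    x `^ a is 1, and makes the power continuous across 0. *)
Lemma continuous_powR_norm a : 0 < a -> continuous (fun x : R => `|x| `^ a).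
Proof.
move=> a0 x.
have [->|x0] := eqVneq x 0.
  rewrite /continuous_at normr0 powR0 ?gt_eqF //.
  apply/cvgrPdist_lt => e e0.
  have d0 : 0 < e `^ a^-1 by rewrite powR_gt0.
  exists (e `^ a^-1) => //= t /=; rewrite !sub0r !normrN => Ht.
  rewrite ger0_norm ?powR_ge0 //.
  have -> : e = (e `^ a^-1) `^ a by rewrite -powRrM mulVf ?gt_eqF // powRr1 // ltW.
  by apply: gt0_ltr_powR => //; rewrite nnegrE // ltW.
apply: (@continuous_comp _ _ _ (fun x : R => `|x|) (fun t : R => t `^ a)).
  exact: norm_continuous.
by apply: (has_deriv_continuous (is_derive1_powR a _)); rewrite normr_gt0.
Qed.

Lemma cvg_powR (T : Type) (F : set_system T) {FF : ProperFilter F} (f : T -> R) (l a : R) : 0 < a ->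
  (\forall z \near F, 0 <= f z) -> f z @[z --> F] --> l ->
  f z `^ a @[z --> F] --> l `^ a.
Proof.
move=> a0 f0 fl.
have l0 : 0 <= l by apply: (cvgr_to_ge fl).
rewrite -(ger0_norm l0).
have H : (fun z => `|f z| `^ a) @ F --> `|l| `^ a.
  apply: (@continuous_cvg _ _ _ F FF f (fun x : R => `|x| `^ a)) => //.
  exact: continuous_powR_norm.
apply: cvg_trans H; apply: near_eq_cvg.
by near=> z; rewrite ger0_norm //; near: z.
Unshelve. all: by end_near. Qed.

Lemma continuous_powR (T : topologicalType) (f : T -> R) (z : T) (a : R) :
  0 < a -> (forall z, 0 <= f z) -> {for z, continuous f} ->
  {for z, continuous (fun z => f z `^ a)}.
Proof. by move=> a0 f0 fc; apply: cvg_powR => //; near=> u. Unshelve. all: by end_near. Qed.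

Lemma continuous_powR_gt0 (T : topologicalType) (f : T -> R) (z : T) (a : R) :
  0 < f z -> {for z, continuous f} -> {for z, continuous (fun z => f z `^ a)}.
Proof.
move=> f0 fc.
apply: (@continuous_cvg _ _ _ (nbhs z) _ f (fun x : R => x `^ a)) => //.
exact: (has_deriv_continuous (is_derive1_powR a f0)).
Qed.

(** The case lo = 0 serves for exponents a >= 1, and the case lo > 0 for all
    exponents a >= 0. *)
Lemma powR_lipschitz (a C lo hi : R) : 0 <= a -> 0 <= lo ->
  (forall t, lo < t <= hi -> a * t `^ (a - 1) <= C) ->
  forall s t, lo <= s <= hi -> lo <= t <= hi ->
  `|s `^ a - t `^ a| <= C * `|s - t|.
Proof.
move=> a0 lo0 HC.
have key s t : lo <= s -> s <= t -> t <= hi -> `|s `^ a - t `^ a| <= C * `|s - t|.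
  move=> ls st th; have s0 := le_trans lo0 ls; have t0 := le_trans s0 st.
  have [->|st'] := eqVneq s t; first by rewrite !subrr normr0 mulr0.
  have slt : s < t by rewrite lt_neqAle st'.
  have C0 : 0 <= C.
    apply: le_trans (HC t _); first by rewrite mulr_ge0 ?powR_ge0.
    by rewrite th (le_lt_trans ls).
  have [<-|an0] := eqVneq 0 a; first by rewrite !powRr0 subrr normr0 mulr_ge0.
  have ap : 0 < a by rewrite lt_neqAle an0.
  rewrite distrC [`|s - t|]distrC !ger0_norm ?subr_ge0 //; last exact: powR_ndecr.
  suff : C * s - `|s| `^ a <= C * t - `|t| `^ a by rewrite !ger0_norm //; lra.
  apply: (@deriv_ndecr R (fun x => C * x - `|x| `^ a) (fun x => C - a * x `^ (a - 1)) s t st).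
  - move=> x _; apply: continuous_add.
      by apply: continuous_mul; [exact: continuous_cstE|exact: cvg_id].
    by apply: continuous_opp; exact: continuous_powR_norm.
  - move=> x /andP[sx _]; have x0 := le_lt_trans s0 sx.
    apply: (has_deriv_gt0_eq (f := fun x => C * x - x `^ a) x0).
      by move=> u u0; rewrite gtr0_norm.
    apply: has_deriv_eq.
      apply: has_derivB; first exact: has_derivZ (has_deriv_id x).
      exact: has_deriv_powR _ x0 (has_deriv_id x).
    by rewrite /= !mulr1.
  - move=> x /andP[sx xt]; rewrite subr_ge0; apply: HC.
    by rewrite (le_lt_trans ls sx) (le_trans (ltW xt)).
move=> s t /andP[ls sh] /andP[lt th]; have [st|ts] := leP s t; first exact: key.
by rewrite distrC [`|s - t|]distrC; apply: key => //; exact: ltW.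
Qed.

End RealPowers.

(** * Directional derivatives and the Euclidean norm *)

Section LineDerivatives.
Context {R : realType}.

(** Directional derivatives reduce to derivatives of functions of one real
    variable. *)
Lemma is_derive_lineP (V : normedModType R) (u : V -> R) (x v : V) (D : R) :
  is_derive x v u D <-> has_deriv (fun h : R => u (h *: v + x)) 0 D.
Proof.
have E : 'D_v u x = 'D_1 (fun h : R => u (h *: v + x)) 0.
  rewrite /derive; set g1 := fun h => h^-1 *: _; set g2 := fun h => h^-1 *: _.
  suff -> : g1 = g2 by [].
  by rewrite funeqE /g1 /g2 => h /=; rewrite addr0 scale0r add0r [_%:A]mulr1.
split=> -[Hd HD]; split.
- exact: (derivable1P u x v).1 Hd.
- by rewrite -E.
- exact: (derivable1P u x v).2 Hd.
- by rewrite E.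
Qed.

(** By the mean value theorem, a derivative that extends continuously to a
    point of continuity is the derivative there. This is what gives the
    derivatives of a radial function at the origin. *)
Lemma has_deriv0_limit (F G : R -> R) :
  {for (0 : R), continuous F} -> {for (0 : R), continuous G} ->
  (forall t : R, t != 0 -> has_deriv F t (G t)) -> has_deriv F 0 (G 0).
Proof.
move=> Fc Gc FG.
have H : (fun h : R => h^-1 *: (F (h *: 1 + 0) - F 0)) @ 0^' --> G 0.
  apply/cvgrPdist_lt => e e0.
  have /cvgrPdist_lt/(_ e e0) := Gc.
  rewrite near_simpl => -[d /= d0 Hd].
  exists d => // h /=; rewrite sub0r normrN => hd h0.
  rewrite [h%:A]mulr1 addr0.
  have Fct (t : R) : {for t, continuous F}.
    by have [->//|/FG/has_deriv_continuous] := eqVneq t 0.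
  have [c cd ->] : exists2 c, `|c| < d & h^-1 *: (F h - F 0) = G c.
    have [h_gt|h_lt|/esym hE] := ltgtP 0 h; last by rewrite hE eqxx in h0.
    - have fd (t : R) : t \in `]0, h[%R -> has_deriv F t (G t).
        by rewrite in_itv /= => /andP[t0 _]; apply: FG; rewrite gt_eqF.
      have [|c] := MVT h_gt fd; first by apply: continuous_subspaceT.
      rewrite in_itv /= => /andP[c0 ch] E; exists c.
        by rewrite gtr0_norm // (lt_trans ch) // -(gtr0_norm h_gt).
      by rewrite E subr0 /GRing.scale /= mulrCA mulVf // mulr1.
    - have fd (t : R) : t \in `]h, 0[%R -> has_deriv F t (G t).
        by rewrite in_itv /= => /andP[_ t0]; apply: FG; rewrite lt_eqF.
      have [|c] := MVT h_lt fd; first by apply: continuous_subspaceT.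
      rewrite in_itv /= => /andP[ch c0] E; exists c.
        by rewrite ltr0_norm //; apply: le_lt_trans hd; rewrite ltr0_norm // lerN2 ltW.
      rewrite -opprB E sub0r /GRing.scale /=; field.
      by [].
  by apply: Hd; rewrite /= sub0r normrN.
split; first by apply/cvg_ex; exists (G 0).
by apply/cvg_lim.
Qed.

(** The difference quotient at 0 is g itself; this differentiates x_i phi(|x|) at
    the origin, where phi is only continuous. *)
Lemma has_deriv0_mulid (g : R -> R) : {for (0 : R), continuous g} ->
  has_deriv (fun h => h * g h) 0 (g 0).
Proof.
move=> gc.
have H : (fun h : R => h^-1 *: ((h *: 1 + 0) * g (h *: 1 + 0) - 0 * g 0)) @ 0^' --> g 0.
  apply: (@cvg_trans _ (g @ 0^')); last exact: (continuous_withinNx g 0).1.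
  apply: near_eq_cvg.
  near=> h; rewrite [h%:A]mulr1 addr0 mul0r subr0 /GRing.scale /= mulKf //.
  near: h; exact: (nbhs_dnbhs_neq (0 : R)).
split; first by apply/cvg_ex; exists (g 0).
by apply/cvg_lim.
Unshelve. all: by end_near. Qed.

End LineDerivatives.

Section EuclideanNorm.
Context {R : realType} {N : nat}.
Implicit Types x y : 'rV[R]_N.

Lemma enorm_ge0 x : 0 <= enorm x. Proof. exact: sqrtr_ge0. Qed.

Lemma sum_sqr_ge0 x : 0 <= \sum_(i < N) x ord0 i ^+ 2.
Proof. by apply: sumr_ge0 => i _; exact: sqr_ge0. Qed.

Lemma enorm_sqr x : enorm x ^+ 2 = \sum_(i < N) x ord0 i ^+ 2.
Proof. by rewrite sqr_sqrtr // sum_sqr_ge0. Qed.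

Lemma enormZ (a : R) x : enorm (a *: x) = `|a| * enorm x.
Proof.
rewrite /enorm -sqrtr_sqr -sqrtrM ?sqr_ge0 //; congr Num.sqrt.
by rewrite mulr_sumr; apply: eq_bigr => i _; rewrite mxE exprMn.
Qed.

Lemma enorm0 : enorm (0 : 'rV[R]_N) = 0.
Proof. by rewrite -[0](scale0r 0) enormZ normr0 mul0r. Qed.

Lemma enorm_eq0 x : (enorm x == 0) = (x == 0).
Proof.
apply/eqP/eqP => [E|->]; last exact: enorm0.
apply/rowP => i; rewrite mxE.
have /eqP := enorm_sqr x; rewrite E expr0n /= eq_sym psumr_eq0; last by move=> *; exact: sqr_ge0.
by move=> /allP/(_ i (mem_index_enum i)); rewrite /= sqrf_eq0 => /eqP.
Qed.

Lemma coord_sqr_le x i : x ord0 i ^+ 2 <= enorm x ^+ 2.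
Proof.
rewrite enorm_sqr (bigD1 i) //= lerDl; apply: sumr_ge0 => j _; exact: sqr_ge0.
Qed.

Lemma coord_le_enorm x i : `|x ord0 i| <= enorm x.
Proof.
rewrite -(@ler_pXn2r _ 2) ?nnegrE ?enorm_ge0 //.
by rewrite real_normK ?num_real // coord_sqr_le.
Qed.

Lemma delta_coord (i j : 'I_N) : ('e_i : 'rV[R]_N) ord0 j = (i == j)%:R.
Proof. by rewrite mxE eqxx eq_sym. Qed.

Lemma enorm_line_sqr x i (h : R) :
  enorm (h *: 'e_i + x) ^+ 2 = enorm x ^+ 2 + 2 * h * x ord0 i + h ^+ 2.
Proof.
rewrite !enorm_sqr (bigD1 i) //= [in RHS](bigD1 i) //= !mxE !eqxx /=.
rewrite (eq_bigr (fun j => x ord0 j ^+ 2)); first by ring.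
by move=> j ji; rewrite !mxE (negbTE ji) andbF mulr0 add0r.
Qed.

Lemma enorm_line x i (h : R) :
  enorm (h *: 'e_i + x) = Num.sqrt (enorm x ^+ 2 + 2 * h * x ord0 i + h ^+ 2).
Proof. by rewrite -enorm_line_sqr sqrtr_sqr ger0_norm // enorm_ge0. Qed.

Lemma enorm_continuous : continuous (@enorm R N).
Proof.
have sc : continuous (fun y : 'rV[R]_N => \sum_(i < N) y ord0 i ^+ 2).
  apply: continuous_big; first exact: add_continuous.
  move=> i _ x; apply: (@continuous_comp _ _ _ (fun y : 'rV[R]_N => y ord0 i) (fun t : R => t ^+ 2)).
    exact: coord_continuous.
  exact: exprn_continuous.
move=> x; apply: (@continuous_comp _ _ _ _ (@Num.sqrt R)); first exact: sc.
exact: sqrt_continuous.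
Qed.

Lemma is_derive_enorm x i : x != 0 ->
  is_derive x 'e_i (@enorm R N) (x ord0 i / enorm x).
Proof.
move=> x0; apply/is_derive_lineP.
rewrite (_ : (fun h => _) = fun h : R =>
  Num.sqrt (enorm x ^+ 2 + 2 * h * x ord0 i + h ^+ 2)); last first.
  by apply/funext => h; rewrite enorm_line.
have xp : 0 < enorm x by rewrite lt_def enorm_eq0 x0 enorm_ge0.
have E0 : enorm x ^+ 2 + 2 * 0 * x ord0 i + 0 ^+ 2 = enorm x ^+ 2 by ring.
apply: has_deriv_eq.
  apply: has_deriv_sqrt; first by rewrite E0 exprn_gt0.
  apply: has_derivD; last exact: has_derivX (has_deriv_id _).
  apply: has_derivD; first exact: has_deriv_cst.
  apply: has_derivM; last exact: has_deriv_cst.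
  apply: has_derivM; [exact: has_deriv_cst|exact: has_deriv_id].
rewrite /= E0 sqrtr_sqr ger0_norm ?ltW //; field.
by rewrite gt_eqF.
Qed.

End EuclideanNorm.

(** * Radial functions of class C2 *)

Section RadialFunctions.
Context {R : realType} {N : nat}.
Implicit Types (x : 'rV[R]_N) (v phi psi : R -> R).

Lemma is_derive_radial (f : R -> R) (d : R) x i : x != 0 ->
  has_deriv f (enorm x) d ->
  is_derive x 'e_i (fun y : 'rV[R]_N => f (enorm y)) (d * (x ord0 i / enorm x)).
Proof.
move=> x0 Hf; apply/is_derive_lineP.
apply: (@has_deriv_comp _ f (fun h : R => enorm (h *: 'e_i + x))).
  by rewrite scale0r add0r.
exact: (is_derive_lineP _ _ _ _).1 (is_derive_enorm i x0).
Qed.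

Lemma continuous_radial (f : R -> R) : continuous (fun t : R => f `|t|) ->
  continuous (fun x : 'rV[R]_N => f (enorm x)).
Proof.
move=> fc x.
rewrite (_ : (fun y : 'rV[R]_N => f (enorm y)) = (fun t : R => f `|t|) \o (@enorm R N)).
  by apply: continuous_comp; [exact: enorm_continuous|exact: fc].
by apply/funext => y /=; rewrite ger0_norm // enorm_ge0.
Qed.

Lemma enorm_axis i (h : R) : enorm (h *: 'e_i : 'rV[R]_N) = `|h|.
Proof.
rewrite -[X in enorm X]addr0 enorm_line enorm0 mxE mulr0 expr0n /= add0r add0r.
by rewrite sqrtr_sqr.
Qed.

Lemma coord_line x i j (h : R) :
  (h *: 'e_j + x) ord0 i = h * (j == i)%:R + x ord0 i.
Proof. by rewrite mxE mxE delta_coord. Qed.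

Section Smooth.
Context (v phi psi : R -> R).
Hypothesis vc : continuous (fun t : R => v `|t|).
Hypothesis phic : continuous (fun t : R => phi `|t|).
Hypothesis psic : continuous (fun t : R => psi `|t|).
Hypothesis psi0 : psi 0 = 0.
Hypothesis dv : forall r : R, 0 < r -> has_deriv v r (r * phi r).
Hypothesis dphi : forall r : R, 0 < r -> has_deriv phi r (psi r / r).

Let u x : R := v (enorm x).

(** At the origin the restriction to an axis is the even function v(|h|), whose
    derivative h phi(|h|) extends continuously by 0. *)
Lemma is_derive1_radial x i : is_derive x 'e_i u (x ord0 i * phi (enorm x)).
Proof.
have [->|x0] := eqVneq x 0; last first.
  have r0 : 0 < enorm x by rewrite lt_def enorm_eq0 x0 enorm_ge0.
  apply: is_derive_eq; first exact: is_derive_radial x0 (dv r0).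
  by field; rewrite gt_eqF.
apply/is_derive_lineP.
rewrite (_ : (fun h => _) = fun h : R => v `|h|); last first.
  by apply/funext => h; rewrite /u addr0 enorm_axis.
have -> : (0 : 'rV[R]_N) ord0 i * phi (enorm (0 : 'rV[R]_N)) = 0 * phi `|(0 : R)|.
  by rewrite mxE enorm0 normr0.
apply: (has_deriv0_limit (G := fun t => t * phi `|t|)) => //.
- exact: vc.
- by apply: continuous_mul; [exact: cvg_id|exact: phic].
move=> t t0; have [t_gt|t_lt|/esym/eqP] := ltgtP 0 t; last by rewrite (negbTE t0).
- apply: (has_deriv_gt0_eq (f := v)) => //.
    by move=> s s0; rewrite gtr0_norm.
  by rewrite gtr0_norm //; exact: dv.
- have nt : 0 < - t by rewrite oppr_gt0.
  apply: (has_deriv_near (f := fun s => v (- s)) nt).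
    move=> s; rewrite ltr_norml => /andP[_ H].
    by rewrite ltr0_norm //; lra.
  apply: has_deriv_eq.
    by apply: has_deriv_comp; [exact: dv|apply: has_derivN; exact: has_deriv_id].
  by rewrite ltr0_norm //; ring.
Qed.

(** At the origin the second summand is 0 / 0 ^+ 2 = 0, so that a single formula
    covers all points. *)
Lemma is_derive2_radial x i j :
  is_derive x 'e_j (fun y : 'rV[R]_N => y ord0 i * phi (enorm y))
   ((j == i)%:R * phi (enorm x)
    + x ord0 i * x ord0 j / enorm x ^+ 2 * psi (enorm x)).
Proof.
apply/is_derive_lineP; have [->|x0] := eqVneq x 0.
  rewrite (_ : (fun h => _) = fun h : R => (j == i)%:R * (h * phi `|h|)); last first.
    by apply/funext => h; rewrite coord_line addr0 enorm_axis mxE addr0; ring.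
  rewrite enorm0 psi0 mulr0 addr0 -[in phi 0](@normr0 _ R).
  by apply: has_derivZ; apply: (@has_deriv0_mulid _ (fun t => phi `|t|)); exact: phic.
have r0 : 0 < enorm x by rewrite lt_def enorm_eq0 x0 enorm_ge0.
rewrite (_ : (fun h => _) = fun h : R =>
  (h * (j == i)%:R + x ord0 i) * phi (enorm (h *: 'e_j + x))); last first.
  by apply/funext => h; rewrite coord_line.
apply: has_deriv_eq.
  apply: has_derivM.
    apply: has_derivD; last exact: has_deriv_cst.
    by apply: has_derivM; [exact: has_deriv_id|exact: has_deriv_cst].
  exact: (is_derive_lineP _ _ _ _).1 (is_derive_radial j x0 (dphi r0)).
rewrite /= scale0r add0r; field.
by rewrite gt_eqF.
Qed.

(** The factor x_i x_j / |x|^2 has no limit at the origin, but it is bounded by 1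
    and psi tends to 0. *)
Lemma continuous2_radial i j :
  continuous (fun x => (j == i)%:R * phi (enorm x)
    + x ord0 i * x ord0 j / enorm x ^+ 2 * psi (enorm x)).
Proof.
move=> x; apply: (@continuous_add R 'rV[R]_N).
  by apply: (@continuous_mul R 'rV[R]_N); [exact: continuous_cstE|exact: continuous_radial].
have psir := continuous_radial psic.
have [->|x0] := eqVneq x 0; last first.
  apply: (@continuous_mul R 'rV[R]_N); last exact: psir.
  apply: (@continuous_mul R 'rV[R]_N).
    by apply: (@continuous_mul R 'rV[R]_N); exact: coord_continuous.
  apply: (@continuous_inv R 'rV[R]_N); first by rewrite sqrf_eq0 enorm_eq0.
  by apply: (@continuous_expn R 'rV[R]_N); exact: enorm_continuous.
suff L : (fun y : 'rV[R]_N => y ord0 i * y ord0 j / enorm y ^+ 2 * psi (enorm y))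
    @ (0 : 'rV[R]_N) --> (0 : R).
  by rewrite /prop_for /continuous_at enorm0 psi0 mulr0.
have bnd (y : 'rV[R]_N) : `|y ord0 i * y ord0 j / enorm y ^+ 2 * psi (enorm y)| <= `|psi (enorm y)|.
  rewrite normrM ler_piMl //.
  have [->|y0] := eqVneq y 0; first by rewrite mxE mul0r mul0r normr0.
  have r0 : 0 < enorm y by rewrite lt_def enorm_eq0 y0 enorm_ge0.
  rewrite normrM normfV [`|_ ^+ 2|]ger0_norm ?sqr_ge0 // ler_pdivrMr ?exprn_gt0 // mul1r.
  by rewrite normrM expr2 ler_pM // coord_le_enorm.
apply: (@cvgrPdist_lt R R 'rV[R]_N (nbhs (0 : 'rV[R]_N)) (nbhs_filter _) _ _).2 => e e0.
have := psir 0; rewrite /continuous_at enorm0 psi0 => /cvgrPdist_lt/(_ e e0) H.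
apply: (@filterS _ (nbhs (0 : 'rV[R]_N)) (nbhs_filter _) _ _ _ H) => y /=.
rewrite !sub0r !normrN => {}H.
exact: le_lt_trans (bnd y) H.
Qed.

Lemma derive1_radial i : 'D_'e_i u = fun x => x ord0 i * phi (enorm x).
Proof. by apply/funext => x; apply: derive_val; exact: is_derive1_radial. Qed.

Lemma derive2_radial i j : 'D_'e_j ('D_'e_i u) =
  fun x => (j == i)%:R * phi (enorm x)
    + x ord0 i * x ord0 j / enorm x ^+ 2 * psi (enorm x).
Proof.
rewrite derive1_radial; apply/funext => x; apply: derive_val; exact: is_derive2_radial.
Qed.

Lemma radial_class_C2 : class_C 2 u.
Proof.
split; first exact: continuous_radial.
move=> i; split; first by move=> x; have [] := is_derive1_radial x i.
rewrite (_ : (fun x => _) = fun x : 'rV[R]_N => x ord0 i * phi (enorm x));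
  last exact: derive1_radial.
split.
  move=> x; apply: (@continuous_mul R 'rV[R]_N); first exact: coord_continuous.
  exact: continuous_radial.
move=> j; split; first by move=> x; have [] := is_derive2_radial x i j.
have := derive2_radial i j; rewrite derive1_radial => E.
change (continuous ('D_'e_j (fun x : 'rV[R]_N => x ord0 i * phi (enorm x)))).
rewrite E; exact: continuous2_radial.
Qed.

Lemma gradient_radial x : gradient u x = phi (enorm x) *: x.
Proof.
apply/rowP => i; rewrite !mxE mulrC.
by have := congr1 (fun F => F x) (derive1_radial i).
Qed.

Lemma laplacian_radial x : laplacian u x = N%:R * phi (enorm x) + psi (enorm x).
Proof.
rewrite /laplacian.
rewrite (eq_bigr (fun i => phi (enorm x)
    + x ord0 i ^+ 2 * (psi (enorm x) / enorm x ^+ 2))).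
  rewrite big_split /= sumr_const card_ord -mulr_suml -enorm_sqr mulr_natl; congr (_ + _).
  have [->|x0] := eqVneq x 0; first by rewrite enorm0 psi0 mul0r mulr0.
  by field; rewrite enorm_eq0.
move=> i _; have := congr1 (fun F => F x) (derive2_radial i i) => /= ->.
by rewrite eqxx mul1r; ring.
Qed.

End Smooth.
End RadialFunctions.

(** * Radial solutions and their profiles *)

Section RadialSolutions.
Context {R : realType} {N : nat}.

(** At the origin the last hypothesis, with psi 0 = 0, reads
    - N phi(0) = v(0)^p 0^q, and contains the convention 0^0 = 1 for q = 0. *)
Lemma radial_positive_solution (p q : R) (v phi psi : R -> R) :
  continuous (fun t : R => v `|t|) -> continuous (fun t : R => phi `|t|) ->
  continuous (fun t : R => psi `|t|) -> psi 0 = 0 ->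
  (forall r : R, 0 < r -> has_deriv v r (r * phi r)) ->
  (forall r : R, 0 < r -> has_deriv phi r (psi r / r)) ->
  (forall r, 0 <= r -> 0 < v r) ->
  (forall r, 0 <= r -> - (N%:R * phi r + psi r) = v r `^ p * (`|phi r| * r) `^ q) ->
  positive_solution p q (fun x : 'rV[R]_N => v (enorm x)).
Proof.
move=> vc phic psic psi0 dv dphi v0 eqn; split.
- exact: (radial_class_C2 vc phic psic psi0 dv dphi).
- by move=> x; apply: v0; exact: enorm_ge0.
move=> x; rewrite (laplacian_radial vc phic psi0 dv dphi).
rewrite (gradient_radial vc phic dv) enormZ; apply: eqn; exact: enorm_ge0.
Qed.

Lemma is_derive_line (V : normedModType R) (u : V -> R) (x v : V) (r D : R) :
  is_derive (r *: v + x) v u D -> has_deriv (fun t => u (t *: v + x)) r D.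
Proof.
move=> /is_derive_lineP H.
rewrite (_ : (fun t => _) = fun t : R => u ((t - r) *: v + (r *: v + x))); last first.
  by apply/funext => t; rewrite addrA -scalerDl subrK.
apply: has_deriv_eq.
  apply: (@has_deriv_comp _ (fun h => u (h *: v + (r *: v + x))) (fun t => t - r)).
    by rewrite subrr; exact: H.
  by apply: has_derivB; [exact: has_deriv_id|exact: has_deriv_cst].
by rewrite subr0 mulr1.
Qed.

Context (hN : (2 <= N)%N) (u : 'rV[R]_N -> R) (x0 : 'rV[R]_N).
Hypothesis uC2 : class_C 2 u.
Hypothesis ur : radial_about x0 u.

Let i0 : 'I_N := Ordinal (ltnW hN).
Let ray (r : R) : 'rV[R]_N := r *: 'e_i0 + x0.
Let f r := u (ray r).
Let w r := - 'D_'e_i0 u (ray r).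
Let n : R := N%:R - 1.

Let derive1_u i x : is_derive x 'e_i u ('D_'e_i u x).
Proof. by case: uC2 => _ /(_ i)[H _]; apply: derivableP. Qed.

Let derive2_u i j x : is_derive x 'e_j ('D_'e_i u) ('D_'e_j ('D_'e_i u) x).
Proof.
by case: uC2 => _ /(_ i)[_ [_ /(_ j)[H _]]]; apply: derivableP; exact: H.
Qed.

Let ray_continuous : continuous ray.
Proof.
move=> r; apply: (@cvgD _ 'rV[R]_N); last exact: cvg_cst.
by apply: (@scalel_continuous _ 'rV[R]_N).
Qed.

Lemma radial_profileE x : u x = f (enorm (x - x0)).
Proof.
case: ur => v Hv; rewrite /f /ray !Hv addrK enorm_axis.
by rewrite ger0_norm // enorm_ge0.
Qed.

Lemma profile_deriv r : has_deriv f r (- w r).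
Proof. by rewrite /w opprK; apply: is_derive_line. Qed.

Lemma slope_continuous : continuous w.
Proof.
move=> r.
have H : {for r, continuous (fun t => 'D_'e_i0 u (ray t))}.
  apply: (@continuous_comp _ _ _ ray ('D_'e_i0 u)); first exact: ray_continuous.
  by case: uC2 => _ /(_ i0)[_ [+ _]]; exact.
exact: (continuous_opp H).
Qed.

Lemma laplacian_ray_continuous : continuous (fun r => laplacian u (ray r)).
Proof.
move=> r; apply: (@continuous_comp _ _ _ ray (laplacian u)).
  exact: ray_continuous.
apply: continuous_big; first exact: add_continuous.
by move=> i _; case: uC2 => _ /(_ i)[_ [_ /(_ i)[_ +]]]; exact.
Qed.

(** The profile along the whole line is even. *)
Lemma slope_at0 : w 0 = 0.
Proof.
have E : f = fun t => f (- t).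
  apply/funext => t; rewrite /f !radial_profileE /ray !addrK !enorm_axis.
  by rewrite normrN.
have H : has_deriv f 0 (w 0).
  rewrite E; apply: has_deriv_eq.
    apply: has_deriv_comp; last by apply: has_derivN; exact: has_deriv_id.
    by rewrite oppr0; exact: profile_deriv.
  by rewrite mulrN1 opprK.
have := has_deriv_unique H (profile_deriv 0); lra.
Qed.

Let side (r t : R) := Num.sqrt (r ^+ 2 + t ^+ 2).

Let side_line i r t : i != i0 ->
  u (t *: 'e_i + ray r) = f (side r t).
Proof.
move=> ii0; rewrite radial_profileE /ray addrA addrK enorm_line enorm_axis.
rewrite mxE mxE eqxx (negbTE ii0) !mulr0 addr0.
by rewrite real_normK // num_real.
Qed.

(** In a direction orthogonal to the ray, u is f at distance
    side r t = (r^2 + t^2)^(1/2); hence its second derivative at t = 0 is f'(r) / r,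
    which gives the first order term of the radial Laplacian. *)
Let derive_side i r t : i != i0 -> 0 < r ->
  'D_'e_i u (t *: 'e_i + ray r) = - w (side r t) / side r t * t.
Proof.
move=> ii0 r0; apply: derive_val; apply/is_derive_lineP.
have s0 : 0 < r ^+ 2 + t ^+ 2 by rewrite ltr_wpDr ?sqr_ge0 // exprn_gt0.
rewrite (_ : (fun h => _) = fun h : R => f (Num.sqrt (r ^+ 2 + (h + t) ^+ 2))); last first.
  by apply/funext => h; rewrite addrA -scalerDl side_line.
apply: has_deriv_eq.
  apply: has_deriv_comp; first by rewrite add0r; exact: profile_deriv.
  apply: has_deriv_sqrt; first by rewrite add0r.
  apply: has_derivD; first exact: has_deriv_cst.
  apply: has_derivX; apply: has_derivD; [exact: has_deriv_id|exact: has_deriv_cst].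
rewrite /= !add0r addr0 mulr1 -/(side r t); field.
by rewrite gt_eqF // sqrtr_gt0.
Qed.

Let side0 r : 0 < r -> side r 0 = r.
Proof. by move=> r0; rewrite /side expr0n /= addr0 sqrtr_sqr gtr0_norm. Qed.

Let derive2_side i r : i != i0 -> 0 < r ->
  'D_'e_i ('D_'e_i u) (ray r) = - w r / r.
Proof.
move=> ii0 r0; apply: derive_val; apply/is_derive_lineP.
rewrite (_ : (fun h => _) = fun h : R => h * (- w (side r h) / side r h)); last first.
  by apply/funext => h; rewrite derive_side // mulrC.
rewrite -[X in - w X / X](side0 r0).
apply: (@has_deriv0_mulid _ (fun h => - w (side r h) / side r h)).
have sc : {for (0 : R), continuous (side r)}.
  apply: (@continuous_comp _ _ _ (fun t : R => r ^+ 2 + t ^+ 2) (@Num.sqrt R)).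
    apply: continuous_add; first exact: continuous_cstE.
    by apply: continuous_expn; exact: cvg_id.
  exact: sqrt_continuous.
apply: continuous_mul.
  apply: continuous_opp.
  by apply: (@continuous_comp _ _ _ (side r) w) => //; exact: slope_continuous.
by apply: continuous_inv => //; rewrite side0 // gt_eqF.
Qed.

Lemma laplacian_ray r : 0 < r ->
  laplacian u (ray r) = 'D_'e_i0 ('D_'e_i0 u) (ray r) - n * w r / r.
Proof.
move=> r0; rewrite /laplacian (bigD1 i0) //=; congr (_ + _).
rewrite (eq_bigr (fun=> - w r / r)); last by move=> i ii0; exact: derive2_side.
rewrite sumr_const cardC1 card_ord -mulr_natl -subn1 natrB ?(ltnW hN) //.
by rewrite /n; ring.
Qed.

Lemma slope_deriv r : 0 < r ->
  has_deriv w r (- laplacian u (ray r) - n * w r / r).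
Proof.
move=> r0; rewrite laplacian_ray // opprB addrAC subrr add0r.
exact: (has_derivN (@is_derive_line 'rV[R]_N ('D_'e_i0 u) x0 'e_i0 r _ (derive2_u _ _ _))).
Qed.

Lemma gradient_ray r : 0 < r -> enorm (gradient u (ray r)) = `|w r|.
Proof.
move=> r0; rewrite /enorm (bigD1 i0) //= big1 ?addr0.
  by rewrite mxE -sqrtr_sqr sqrrN.
move=> i ii0; rewrite mxE.
have := derive_side 0 ii0 r0; rewrite scale0r add0r mulr0 => ->.
by rewrite expr0n.
Qed.

End RadialSolutions.

(** * The flux and the Pohozaev function *)

Section Pohozaev.
Context {R : realType}.
Implicit Types (p q n r : R) (f w : R -> R).

(** The radial form of the equation in dimension n + 1, where w = - f' >= 0. *)
Definition profile_ode p q n f w r :=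
  has_deriv f r (- w r) /\
  has_deriv w r (f r `^ p * w r `^ q - n * w r / r).

(** Multiplying the radial equation by e r^(n e) w^(-q), e = 1 - q, removes the
    gradient from the right-hand side and turns the left-hand side into the
    derivative of this function. *)
Definition flux q n w r := r `^ (n * (1 - q)) * w r `^ (1 - q).

(** The Pohozaev function of the (2 - q)-Laplacian in dimension n (1 - q) + 1,
    with the kinetic and the boundary terms grouped: r w - (n - 1) f is
    nonpositive on solutions, so that the sign of the first summand is known. *)
Definition pohozaev p q n f w r :=
  (1 - q) / (2 - q) * (r * w r - (n - 1) * f r) * flux q n w r
  + (1 - q) / (p + 1) * (r `^ (n * (1 - q) + 1) * f r `^ (p + 1)).

Lemma flux_deriv p q n f w r : 0 < r -> 0 < w r ->
  profile_ode p q n f w r ->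
  has_deriv (flux q n w) r ((1 - q) * (r `^ (n * (1 - q)) * f r `^ p)).
Proof.
move=> r0 w0 [_ dw]; apply: has_deriv_eq.
  apply: has_derivM.
    exact: (has_deriv_powR _ r0 (has_deriv_id r)).
  exact: (has_deriv_powR _ w0 dw).
rewrite /= !powRB1 //.
have E : w r `^ (1 - q) * w r `^ q = w r.
  by rewrite -powRD ?subrK ?powRr1 ?ltW // (gt_eqF w0) implybT.
set X := r `^ _; set F := f r `^ p.
have e0 : 0 < w r `^ (1 - q) by rewrite powR_gt0.
have -> : w r `^ q = w r / w r `^ (1 - q) by rewrite -[X in X / _]E mulrC mulKf // gt_eqF.
by field; rewrite !gt_eqF.
Qed.

(** The coefficients are chosen so that the terms w A and r^d f^p w of the
    derivative cancel, where A is the flux and d = n (1 - q) + 1. *)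
Lemma pohozaev_deriv p q n f w r : 0 < r -> 0 < w r -> 0 < f r -> q < 1 ->
  0 < p + 1 -> profile_ode p q n f w r ->
  has_deriv (pohozaev p q n f w) r
    ((1 - q) * ((n * (1 - q) + 1) / (p + 1) - (n - 1) * (1 - q) / (2 - q))
      * (r `^ (n * (1 - q)) * f r `^ (p + 1))).
Proof.
move=> r0 w0 f0 q1 p1 ode; have dA := flux_deriv r0 w0 ode.
have [df dw] := ode.
apply: has_deriv_eq.
  apply: has_derivD.
    apply: has_derivM; last exact: dA.
    apply: has_derivZ; apply: has_derivB; last by apply: has_derivZ; exact: df.
    by apply: has_derivM; [exact: has_deriv_id|exact: dw].
  apply: has_derivZ; apply: has_derivM.
    exact: (has_deriv_powR _ r0 (has_deriv_id r)).
  exact: (has_deriv_powR _ f0 df).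
rewrite /= !addrK !powRD1 //.
have E : w r `^ (1 - q) * w r `^ q = w r.
  by rewrite -powRD ?subrK ?powRr1 ?ltW // (gt_eqF w0) implybT.
rewrite /flux; set X := r `^ _; set F := f r `^ p.
have q0 : 0 < w r `^ q by rewrite powR_gt0.
have -> : w r `^ (1 - q) = w r / w r `^ q by rewrite -[X in X / _]E mulfK // gt_eqF.
field; rewrite !gt_eqF //=; lra.
Qed.

End Pohozaev.

(** * Necessary conditions on the exponents *)

Section Nonexistence.
Context {R : realType}.
Implicit Types (r s t : R).

(* n stands for N - 1. The equation has |w| because the sign of w is a consequence
   of it (slope_ge0). *)
Context (p q n : R) (f w : R -> R).
Hypothesis n_ge1 : 1 <= n.
Hypothesis f_gt0 : forall r, 0 < f r.
Hypothesis df : forall r, has_deriv f r (- w r).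
Hypothesis wc : continuous w.
Hypothesis w0 : w 0 = 0.
Hypothesis dw : forall r, 0 < r ->
  has_deriv w r (f r `^ p * `|w r| `^ q - n * w r / r).

Let n_gt0 : 0 < n. Proof. exact: lt_le_trans n_ge1. Qed.

Let fc : continuous f. Proof. by move=> r; exact: has_deriv_continuous (df r). Qed.

(** r^n w is, up to a constant, minus the flux of the gradient through spheres,
    and u is superharmonic. *)
Lemma weighted_slope_ndecr r s : 0 <= r <= s -> r `^ n * w r <= s `^ n * w s.
Proof.
move=> /andP[r0 rs]; have s0 := le_trans r0 rs.
have := @deriv_ndecr R (fun t => `|t| `^ n * w t)
  (fun t => t `^ n * (f t `^ p * `|w t| `^ q)) r s rs.
rewrite /= !ger0_norm //; apply.
- by move=> t _; apply: continuous_mul; [exact: continuous_powR_norm|exact: wc].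
- move=> t /andP[rt _]; have t0 := le_lt_trans r0 rt.
  apply: (has_deriv_gt0_eq (f := fun t => t `^ n * w t) t0).
    by move=> u u0; rewrite gtr0_norm.
  apply: has_deriv_eq.
    apply: has_derivM; last exact: dw.
    exact: (has_deriv_powR _ t0 (has_deriv_id t)).
  rewrite /= powRB1 //; field; by rewrite gt_eqF.
- by move=> t _; rewrite !mulr_ge0 // powR_ge0.
Qed.

Lemma slope_ge0 r : 0 <= r -> 0 <= w r.
Proof.
rewrite le_eqVlt => /predU1P[<-|r0]; first by rewrite w0.
have := @weighted_slope_ndecr 0 r; rewrite lexx ltW // w0 mulr0 => /(_ isT).
by rewrite pmulr_rge0 // powR_gt0.
Qed.

Lemma slope_gt0_after r s : 0 < r -> r <= s -> 0 < w r -> 0 < w s.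
Proof.
move=> r0 rs wr; have s0 := lt_le_trans r0 rs.
have := @weighted_slope_ndecr r s; rewrite ltW // rs => /(_ isT) H.
have : 0 < s `^ n * w s by apply: lt_le_trans H; rewrite mulr_gt0 // powR_gt0.
by rewrite pmulr_rgt0 // powR_gt0.
Qed.

Lemma profile_nincr r s : 0 <= r <= s -> f s <= f r.
Proof.
move=> /andP[r0 rs]; rewrite -lerN2.
apply: (@deriv_ndecr R (fun t => - f t) (fun t => w t)) => //.
- by move=> t _; apply: continuous_opp; exact: fc.
- by move=> t _; apply: has_deriv_eq; [apply: has_derivN; exact: df|rewrite opprK].
- by move=> t /andP[rt _]; apply: slope_ge0; rewrite ltW // (le_lt_trans r0).
Qed.

(** The slope stays positive once it is positive, so that the profile is constant
    up to r0 and strictly decreasing afterwards; r0 may be positive. *)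
Lemma slope_onset : (exists2 r, 0 < r & w r != 0) ->
  exists r0, [/\ 0 <= r0, w r0 = 0 & forall r, r0 < r -> 0 < w r].
Proof.
move=> [r1 r1_gt0 wr1].
pose S := [set r | 0 < r /\ 0 < w r]%classic.
have S1 : S r1 by split => //; rewrite lt_neqAle eq_sym wr1 slope_ge0 // ltW.
have Slb : lbound S 0 by move=> r [/ltW].
have Si : has_inf S by split; [exists r1|exists 0].
have after r : inf S < r -> 0 < w r.
  move=> /(inf_lt Si.1)[s [s0 ws] sr].
  exact: slope_gt0_after s0 (ltW sr) ws.
have i0 : 0 <= inf S by apply: lb_le_inf => //; exists r1.
exists (inf S); split => //.
apply/eqP/negPn/negP => wi.
have wi0 : 0 < w (inf S) by rewrite lt_neqAle eq_sym wi slope_ge0.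
have ipos : 0 < inf S.
  by rewrite lt_neqAle i0 andbT; apply: contraNneq wi => <-; rewrite w0.
have [e /= e0 He] : \forall t \near inf S, 0 < w t.
  by apply: (cvgr_gt _ (@wc (inf S))).
pose t := inf S - Num.min e (inf S) / 2.
have m0 : 0 < Num.min e (inf S) by rewrite lt_min e0.
have me : Num.min e (inf S) <= e by rewrite ge_min lexx.
have mi : Num.min e (inf S) <= inf S by rewrite ge_min lexx orbT.
have t0 : 0 < t by rewrite /t; lra.
have : S t.
  split => //; apply: He; rewrite /= /t opprB addrC subrK.
  by rewrite gtr0_norm; lra.
move=> /(ge_inf Si.2); rewrite /t; lra.
Qed.

Context (r0 : R).
Hypothesis r0_ge0 : 0 <= r0.
Hypothesis wr0 : w r0 = 0.
Hypothesis w_gt0 : forall r, r0 < r -> 0 < w r.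

Let pos r : r0 < r -> 0 < r. Proof. exact: le_lt_trans. Qed.

Let ode r : r0 < r -> profile_ode p q n f w r.
Proof.
move=> rr; split; first exact: df.
by have := dw (pos rr); rewrite gtr0_norm // w_gt0.
Qed.

(** B is minus the Laplacian along the ray. If q < 0 then f^p = w^(-q) B beyond r0,
    and w^(-q) tends to 0 at r0, whereas f(r0) > 0. *)
Lemma gradient_exponent_ge0 (B : R -> R) : continuous B ->
  (forall r, 0 < r -> B r = f r `^ p * `|w r| `^ q) -> 0 <= q.
Proof.
move=> Bc HB; rewrite leNgt; apply/negP => q0.
have nq : 0 < - q by rewrite oppr_gt0.
(* g vanishes beyond r0, hence at r0, where its value is - f(r0)^p. *)
pose g t := `|w t| `^ (- q) * B t - f t `^ p.
have gc : {for r0, continuous g}.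
  apply: continuous_add.
    apply: continuous_mul; last exact: Bc.
    apply: (@continuous_comp _ _ _ w (fun x : R => `|x| `^ (- q))); first exact: wc.
    exact: continuous_powR_norm.
  by apply: continuous_opp; apply: continuous_powR_gt0 => //; exact: fc.
have : 0 <= g r0.
  apply: (@right_limit_ge R g 0 r0 (r0 + 1)); rewrite ?ltrDl // => t /andP[rt _].
  rewrite /g HB ?pos // mulrCA -powRD ?addNr ?powRr0 ?mulr1 ?subrr //.
  by rewrite eqxx normr_eq0 gt_eqF // w_gt0.
rewrite /g wr0 normr0 powR0 ?gt_eqF // mul0r sub0r oppr_ge0.
by apply/negP; rewrite -ltNge powR_gt0.
Qed.

(** If q >= 1 then w' <= L w on [r0, r0 + 1], so that e^(- L t) w does not increase
    from its value 0 at r0. *)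
Lemma gradient_exponent_lt1 : q < 1.
Proof.
rewrite ltNge; apply/negP => q1.
have r1 : r0 < r0 + 1 by rewrite ltrDl.
have [c _ Hc] := @EVT_max R w r0 (r0 + 1) (ltW r1)
  (continuous_subspaceT wc).
(* f lies between f (r0 + 1) and f r0, so that M bounds f^p for both signs of p. *)
pose M := f r0 `^ p + f (r0 + 1) `^ p.
pose L := M * w c `^ (q - 1).
have : expR (- L * (r0 + 1)) * w (r0 + 1) <= expR (- L * r0) * w r0.
  rewrite -lerN2.
  apply: (@deriv_ndecr R (fun t => - (expR (- L * t) * w t))
    (fun t => - (expR (- L * t) * (- L * w t + (f t `^ p * w t `^ q - n * w t / t))))).
  - exact: ltW.
  - move=> t _; apply: continuous_opp; apply: continuous_mul; last exact: wc.
    apply: has_deriv_continuous; apply: has_deriv_expR.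
    by apply: has_derivZ; exact: has_deriv_id.
  - move=> t /andP[rt _]; apply: has_derivN; apply: has_deriv_eq.
      apply: has_derivM; last exact: (ode rt).2.
      by apply: has_deriv_expR; apply: has_derivZ; exact: has_deriv_id.
    by rewrite /=; ring.
  - move=> t /andP[rt tr]; rewrite oppr_ge0 pmulr_rle0 ?expR_gt0 //.
    have wt := w_gt0 rt; have t0 := pos rt.
    have H1 : f t `^ p <= M.
      rewrite /M; have [p0|p0] := leP 0 p.
        apply: (@le_trans _ _ (f r0 `^ p)); last by rewrite lerDl powR_ge0.
        by apply: powR_ndecr; rewrite ?(ltW (f_gt0 _)) // profile_nincr // r0_ge0 ltW.
      apply: (@le_trans _ _ (f (r0 + 1) `^ p)); last by rewrite lerDr powR_ge0.
      by apply: powR_nincr; rewrite ?f_gt0 // ?profile_nincr ?(ltW p0) // !ltW.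
    have H2 : w t `^ q <= w c `^ (q - 1) * w t.
      rewrite -{1}(subrK 1 q) powRD1 // ler_pM2r //.
      apply: powR_ndecr; rewrite ?subr_ge0 // ?(ltW wt) //.
      by apply: Hc; rewrite in_itv /= !ltW.
    have H3 : 0 <= n * w t / t by rewrite divr_ge0 ?mulr_ge0 // ltW.
    have H4 : f t `^ p * w t `^ q <= M * (w c `^ (q - 1) * w t).
      by apply: ler_pM => //; exact: powR_ge0.
    rewrite /L mulNr -mulrA; lra.
rewrite wr0 mulr0 pmulr_rle0 ?expR_gt0 // leNgt; move/negP; apply.
exact: w_gt0.
Qed.

(** Then f' <= - c / r, and f becomes negative. *)
Lemma log_divergence (s c : R) : r0 < s -> 0 < c ->
  (forall r, s <= r -> c <= r * w r) -> False.
Proof.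
move=> rs c0 H; have s0 := pos rs.
(* The radius at which the logarithmic upper bound on f vanishes. *)
pose r := s * expR (f s / c).
have sr : s <= r.
  by rewrite ler_peMr ?ltW // -expR0 ltr_expR divr_gt0.
have : f r + c * ln r <= f s + c * ln s.
  rewrite -lerN2.
  apply: (@deriv_ndecr R (fun t => - (f t + c * ln t)) (fun t => w t - c / t)) => //.
  - move=> t /andP[st _]; apply: continuous_opp; apply: continuous_add; first exact: fc.
    apply: continuous_mul; first exact: continuous_cstE.
    exact: has_deriv_continuous (has_deriv_ln (lt_le_trans s0 st) (has_deriv_id t)).
  - move=> t /andP[st _]; apply: has_deriv_eq.
      apply: has_derivN; apply: has_derivD; first exact: df.
      exact: has_derivZ (has_deriv_ln (lt_trans s0 st) (has_deriv_id t)).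
    by rewrite opprD opprK mul1r.
  - move=> t /andP[st _]; rewrite subr_ge0 ler_pdivrMr ?(lt_trans s0) //.
    by rewrite mulrC; apply: H; exact: ltW.
rewrite /r lnM ?posrE ?expR_gt0 // expRK mulrDr mulrCA divff ?gt_eqF // mulr1.
have := f_gt0 (s * expR (f s / c)); lra.
Qed.

(** The function r w - (n - 1) f is nondecreasing, its derivative being r f^p w^q;
    if it were positive somewhere, r w would be bounded below by a positive
    constant. *)
Lemma slope_le_profile r : r0 < r -> r * w r <= (n - 1) * f r.
Proof.
move=> rr; rewrite leNgt; apply/negP => H.
apply: (@log_divergence r (r * w r - (n - 1) * f r)) => //; first by rewrite subr_gt0.
move=> s rs; have r_gt := pos rr.
suff : r * w r - (n - 1) * f r <= s * w s - (n - 1) * f s.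
  have : 0 <= (n - 1) * f s by rewrite mulr_ge0 ?subr_ge0 // ltW.
  lra.
apply: (@deriv_ndecr R (fun t => t * w t - (n - 1) * f t)
  (fun t => t * (f t `^ p * w t `^ q))) => //.
- move=> t _; apply: continuous_add.
    by apply: continuous_mul; [exact: cvg_id|exact: wc].
  apply: continuous_opp; apply: continuous_mul; [exact: continuous_cstE|exact: fc].
- move=> t /andP[rt _]; have t0 := lt_trans r_gt rt; apply: has_deriv_eq.
    apply: has_derivB; last exact: has_derivZ (df t).
    exact: has_derivM (has_deriv_id t) (ode (lt_trans rr rt)).2.
  by rewrite /=; field; rewrite gt_eqF.
- move=> t /andP[rt _]; rewrite !mulr_ge0 ?powR_ge0 //.
  exact: ltW (lt_trans r_gt rt).
Qed.

(** For N = 2 the previous bound leaves no room for a positive slope. *)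
Lemma dimension_gt1 : 1 < n.
Proof.
rewrite lt_neqAle n_ge1 andbT; apply/eqP => n1.
have r1 : r0 < r0 + 1 by rewrite ltrDl.
have := slope_le_profile r1; rewrite -n1 subrr mul0r leNgt => /negP; apply.
by rewrite mulr_gt0 ?w_gt0 // pos.
Qed.

Hypothesis q_lt1 : q < 1.
Let e : R := 1 - q.
Let d : R := n * e + 1.
Let e_gt0 : 0 < e. Proof. by rewrite subr_gt0. Qed.
Let d_gt0 : 0 < d. Proof. by rewrite addr_gt0 // mulr_gt0. Qed.

(** Integration of the law of the flux from r1 to r. *)
Lemma flux_lower r1 r mu : r0 < r1 -> r1 <= r ->
  (forall t, r1 <= t <= r -> mu <= f t `^ p) ->
  e / d * mu * (r `^ d - r1 `^ d) <= flux q n w r.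
Proof.
move=> rr1 r1r Hmu; have r1_gt0 := pos rr1.
suff : flux q n w r1 - e / d * mu * r1 `^ d <= flux q n w r - e / d * mu * r `^ d.
  have : 0 <= flux q n w r1 by rewrite mulr_ge0 ?powR_ge0.
  rewrite mulrBr; lra.
have D t : r1 <= t -> has_deriv (fun t => flux q n w t - e / d * mu * t `^ d) t
    (e * (t `^ (n * e) * (f t `^ p - mu))).
  move=> r1t; have rt := lt_le_trans rr1 r1t; have t0 := pos rt.
  apply: has_deriv_eq.
    apply: has_derivB; first exact: flux_deriv t0 (w_gt0 rt) (ode rt).
    exact: has_derivZ (has_deriv_powR _ t0 (has_deriv_id t)).
  by rewrite /= -/e /d addrK; field; rewrite -/d gt_eqF.
apply: (@deriv_ndecr R (fun t => flux q n w t - e / d * mu * t `^ d)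
  (fun t => e * (t `^ (n * e) * (f t `^ p - mu)))); first exact: r1r.
- move=> t /andP[/D H _]; exact: has_deriv_continuous H.
- by move=> t /andP[/ltW/D H _].
- move=> t /andP[H1 H2]; rewrite mulr_ge0 ?(ltW e_gt0) // mulr_ge0 ?powR_ge0 //.
  by rewrite subr_ge0; apply: Hmu; rewrite !ltW.
Qed.

(** The flux is at least of order mu r^d, that is w^e >= c mu r, and r w is at most
    (n - 1) f. The constant mu is f(r)^p if p >= 0, and f(r1)^p if p < 0. *)
Lemma profile_upper r1 r mu : r0 < r1 -> r1 <= r -> 2 * r1 `^ d <= r `^ d ->
  0 <= mu -> (forall t, r1 <= t <= r -> mu <= f t `^ p) ->
  e / d / 2 * mu * r `^ (1 + e) <= ((n - 1) * f r) `^ e.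
Proof.
move=> rr1 r1r H2 mu0 Hmu; have rr := lt_le_trans rr1 r1r.
have r_gt0 := pos rr.
have H := flux_lower rr1 r1r Hmu.
apply: (@le_trans _ _ ((r * w r) `^ e)); last first.
  apply: powR_ndecr; first exact: ltW.
    by rewrite mulr_ge0 // ltW // w_gt0.
  exact: slope_le_profile.
have X0 : 0 < r `^ (n * e) by rewrite powR_gt0.
have rd : r `^ d = r `^ (n * e) * r by rewrite powRD1.
rewrite powRM ?(ltW r_gt0) ?(ltW (w_gt0 rr)) //.
rewrite (addrC 1 e) powRD1 // -(ler_pM2l X0).
have -> : r `^ (n * e) * (e / d / 2 * mu * (r `^ e * r))
  = r `^ e * (e / d * mu * (r `^ d / 2)) by rewrite rd; field; rewrite gt_eqF.
rewrite [leRHS]mulrCA ler_pM2l ?powR_gt0 //.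
apply: le_trans H; apply: ler_wpM2l; last by lra.
by rewrite mulr_ge0 // divr_ge0 // ltW.
Qed.

Let radius_doubling r1 : r0 < r1 ->
  exists2 r2, r1 <= r2 & forall r, r2 <= r -> 2 * r1 `^ d <= r `^ d.
Proof.
move=> rr1; have r1_gt0 := pos rr1.
have [r2 r12 H] := @powR_unbounded _ d 1 (2 * r1 `^ d) r1 d_gt0 ltr01.
exists r2 => // r rr; apply: (@le_trans _ _ (r2 `^ d)).
  by rewrite -[leRHS]mul1r ltW.
apply: powR_ndecr => //; first exact: ltW.
exact: ltW (lt_le_trans r1_gt0 r12).
Qed.

(** For p < 0 the source does not decrease to 0 with f, and the upper bound on the
    bounded function f would be a positive power of r. *)
Lemma source_exponent_ge0 : 0 <= p.
Proof.
rewrite leNgt; apply/negP => p0.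
have rr1 : r0 < r0 + 1 by rewrite ltrDl.
set r1 := r0 + 1 in rr1; have r1_gt0 := pos rr1.
have [r2 r12 Hr2] := radius_doubling rr1.
have fr1 := f_gt0 r1.
have c0 : 0 < e / d / 2 * f r1 `^ p.
  by rewrite mulr_gt0 ?powR_gt0 // divr_gt0 // divr_gt0.
have e1 : 0 < 1 + e by rewrite addr_gt0.
have [r rr2 Hr] := @powR_unbounded _ _ _ (((n - 1) * f r1) `^ e) r2 e1 c0.
have r1r := le_trans r12 rr2.
have : e / d / 2 * f r1 `^ p * r `^ (1 + e) <= ((n - 1) * f r) `^ e.
  apply: (@profile_upper r1) => //; rewrite ?powR_ge0 ?Hr2 // => t /andP[r1t _].
  by apply: powR_nincr; rewrite ?(ltW p0) // profile_nincr // r1t ltW.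
have : ((n - 1) * f r) `^ e <= ((n - 1) * f r1) `^ e.
  apply: powR_ndecr; first exact: ltW.
    by rewrite mulr_ge0 ?subr_ge0 // ltW.
  by rewrite ler_wpM2l ?subr_ge0 // profile_nincr // r1r ltW.
move=> H1 H3; have := lt_le_trans Hr (le_trans H3 H1).
by rewrite ltxx.
Qed.

Hypothesis p_ge0 : 0 <= p.
Let p1_gt0 : 0 < p + 1. Proof. by rewrite ltr_wpDl. Qed.
Let e1_gt0 : 0 < 1 + e. Proof. by rewrite addr_gt0. Qed.
Let eE : 2 - q = 1 + e. Proof. by rewrite /e; ring. Qed.

Hypothesis subcritical : (n - 1) * e / (1 + e) < d / (p + 1).

Lemma pohozaev_incr r1 r : r0 < r1 -> r1 < r ->
  pohozaev p q n f w r1 < pohozaev p q n f w r.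
Proof.
move=> rr1 r1r.
have D t : r1 <= t -> has_deriv (pohozaev p q n f w) t
    (e * (d / (p + 1) - (n - 1) * e / (1 + e)) * (t `^ (n * e) * f t `^ (p + 1))).
  move=> r1t; have rt := lt_le_trans rr1 r1t.
  have := pohozaev_deriv (pos rt) (w_gt0 rt) (f_gt0 t) q_lt1 p1_gt0 (ode rt).
  by rewrite -/e eE.
apply: (@deriv_incr R (pohozaev p q n f w) (fun t =>
  e * (d / (p + 1) - (n - 1) * e / (1 + e)) * (t `^ (n * e) * f t `^ (p + 1))));
  first exact: r1r.
- move=> t /andP[/D H _]; exact: has_deriv_continuous H.
- by move=> t /andP[/ltW/D H _].
- move=> t /andP[H1 H2]; rewrite mulr_gt0 ?mulr_gt0 ?powR_gt0 ?subr_gt0 //.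
  by apply: lt_trans H1; exact: pos.
Qed.

(** The first summand of the Pohozaev function is nonpositive. *)
Lemma pohozaev_le r : r0 < r ->
  pohozaev p q n f w r <= e / (p + 1) * (r `^ d * f r `^ (p + 1)).
Proof.
move=> rr; rewrite /pohozaev -/e -/d gerDr -mulrA.
rewrite pmulr_rle0; last by rewrite divr_gt0 // eE.
by rewrite mulr_le0_ge0 ?subr_le0 ?slope_le_profile // mulr_ge0 ?powR_ge0.
Qed.

(** The value at r0 is nonnegative because the slope vanishes there; only the
    boundary term g has to be shown to tend to 0. *)
Lemma pohozaev_gt0 r : r0 < r -> 0 < pohozaev p q n f w r.
Proof.
move=> rr; pose r1 := (r0 + r) / 2.
have rr1 : r0 < r1 by rewrite /r1; lra.
have r1r : r1 < r by rewrite /r1; lra.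
apply: le_lt_trans (pohozaev_incr rr1 r1r).
(* g is the boundary term of the Pohozaev function, and vanishes at r0. *)
pose g t := e / (2 - q) * ((n - 1) * f t) * (`|t| `^ (n * e) * `|w t| `^ e).
have gc : {for r0, continuous g}.
  apply: continuous_mul; apply: continuous_mul.
  - exact: continuous_cstE.
  - by apply: continuous_mul; [exact: continuous_cstE|exact: fc].
  - by apply: continuous_powR_norm; rewrite mulr_gt0.
  - apply: (@continuous_comp _ _ _ w (fun x : R => `|x| `^ e)); first exact: wc.
    exact: continuous_powR_norm.
have := @right_limit_ge R g (- pohozaev p q n f w r1) r0 r1 rr1 gc.
rewrite {2}/g wr0 normr0 powR0 ?gt_eqF // !mulr0 oppr_le0; apply.
move=> t /andP[rt tr1]; have t0 := pos rt; have wt := w_gt0 rt.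
have := pohozaev_incr rt tr1.
suff : - g t <= pohozaev p q n f w t by lra.
rewrite /g /pohozaev /flux -/e -/d !gtr0_norm //.
have H1 : 0 <= e / (2 - q) * (t * w t) * (t `^ (n * e) * w t `^ e).
  by rewrite !mulr_ge0 ?powR_ge0 ?invr_ge0 ?eE // ltW.
have H2 : 0 <= e / (p + 1) * (t `^ d * f t `^ (p + 1)).
  by rewrite !mulr_ge0 ?powR_ge0 ?invr_ge0 // ltW.
rewrite -subr_ge0; apply: (le_trans (addr_ge0 H1 H2)); rewrite le_eqVlt.
by apply/orP; left; apply/eqP; ring.
Qed.

(** The Pohozaev function gives r^d f^(p + 1) >= D > 0, while profile_upper with
    mu = f(r)^p gives r^(1 + e) f^(p - e) <= C. If p < e the second bound alone is
    absurd, f being bounded. If p >= e, inserting the first one into it leaves a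
    power of r with exponent
    1 + e - d (p - e) / (p + 1) = (1 + e) (d / (p + 1) - (n - 1) e / (1 + e)) > 0. *)
Lemma no_subcritical_profile : False.
Proof.
have rr1 : r0 < r0 + 1 by rewrite ltrDl.
set r1 := r0 + 1 in rr1; have r1_gt0 := pos rr1.
have n1 : 0 < n - 1 by rewrite subr_gt0 dimension_gt1.
have [r2 r12 Hr2] := radius_doubling rr1.
have P0 := pohozaev_gt0 rr1.
set P1 := pohozaev p q n f w r1 in P0.
pose D := P1 * (p + 1) / e.
have D0 : 0 < D by rewrite divr_gt0 // mulr_gt0.
have lower r : r1 < r -> D <= r `^ d * f r `^ (p + 1).
  move=> r1r; have := pohozaev_le (lt_trans rr1 r1r).
  have := pohozaev_incr rr1 r1r; rewrite -/P1 => H1 H2.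
  have := le_trans (ltW H1) H2.
  by rewrite /D ler_pdivrMr // mulrAC ler_pdivlMr // [_ * e]mulrC.
have upper r : r2 <= r -> e / d / 2 * r `^ (1 + e) * f r `^ (p - e) <= (n - 1) `^ e.
  move=> r2r; have r1r := le_trans r12 r2r.
  have fr := f_gt0 r; have X0 : 0 < f r `^ e by rewrite powR_gt0.
  rewrite -(ler_pM2r X0) -powRM ?(ltW n1) ?(ltW fr) //.
  have -> : e / d / 2 * r `^ (1 + e) * f r `^ (p - e) * f r `^ e
      = e / d / 2 * f r `^ p * r `^ (1 + e).
    have -> : f r `^ p = f r `^ (p - e) * f r `^ e.
      by rewrite -powRD ?subrK // (gt_eqF fr) implybT.
    by ring.
  apply: (@profile_upper r1) => //; rewrite ?powR_ge0 ?Hr2 //.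
  move=> t /andP[r1t tr]; apply: powR_ndecr => //; first exact: ltW.
  by apply: profile_nincr; rewrite tr ltW // (lt_le_trans r1_gt0).
have [pe|pe] := ltP p e.
  have c0 : 0 < e / d / 2 * f r1 `^ (p - e).
    by rewrite mulr_gt0 ?powR_gt0 // divr_gt0 // divr_gt0.
  have [r r2r Hr] := @powR_unbounded _ _ _ ((n - 1) `^ e) r2 e1_gt0 c0.
  suff : e / d / 2 * f r1 `^ (p - e) * r `^ (1 + e) <= (n - 1) `^ e by rewrite leNgt Hr.
  apply: le_trans (upper r r2r); rewrite mulrAC ler_wpM2l //.
    by rewrite mulr_ge0 ?powR_ge0 // divr_ge0 // divr_ge0 // ltW.
  apply: powR_nincr; rewrite ?f_gt0 ?subr_le0 ?(ltW pe) //.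
  by apply: profile_nincr; rewrite ltW // (le_trans r12).
pose th := (p - e) / (p + 1).
have th0 : 0 <= th by rewrite divr_ge0 ?subr_ge0 // ltW.
pose al := 1 + e - d * th.
have al0 : 0 < al.
  have -> : al = (1 + e) * (d / (p + 1) - (n - 1) * e / (1 + e)).
    by rewrite /al /th /d; field; rewrite !gt_eqF.
  by rewrite mulr_gt0 // subr_gt0.
have c0 : 0 < e / d / 2 * D `^ th.
  by rewrite mulr_gt0 ?powR_gt0 // divr_gt0 // divr_gt0.
have [r r3 Hr] := @powR_unbounded _ _ _ ((n - 1) `^ e) (r2 + 1) al0 c0.
have r2r : r2 < r by rewrite (lt_le_trans _ r3) // ltrDl.
have r1r : r1 < r := le_lt_trans r12 r2r.
have r_gt0 := lt_trans r1_gt0 r1r.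
suff : e / d / 2 * D `^ th * r `^ al <= (n - 1) `^ e by rewrite leNgt Hr.
apply: le_trans (upper r (ltW r2r)).
rewrite -!mulrA ler_wpM2l ?(ltW e_gt0) // ler_wpM2l ?invr_ge0 ?(ltW d_gt0) //.
rewrite ler_wpM2l ?invr_ge0 //.
have fE : f r `^ (p - e) = (f r `^ (p + 1)) `^ th.
  by rewrite -powRrM; congr (_ `^ _); rewrite /th; field; rewrite gt_eqF.
have rE : r `^ (1 + e) = r `^ al * (r `^ d) `^ th.
  rewrite -powRrM -powRD; last by rewrite (gt_eqF r_gt0) implybT.
  by congr (_ `^ _); rewrite /al; ring.
rewrite fE rE -mulrA -powRM ?powR_ge0 // mulrC ler_wpM2l ?powR_ge0 //.
by apply: powR_ndecr => //; [exact: ltW|exact: lower].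
Qed.

End Nonexistence.

(** * Primitives and Volterra fixed points *)

Section Primitive.
Context {R : realType}.
Notation mu := (@lebesgue_measure R).

Let integral_from (f : R -> R) (x : R) : R := (\int[mu]_(t in `[(-1)%R, x]) f t)%R.

Let integral_from_deriv (f : R -> R) (x : R) : continuous f -> -1 < x ->
  has_deriv (integral_from f) x (f x).
Proof.
move=> fc x1.
have xu : x < x + 1 by rewrite ltrDl.
have fi : mu.-integrable `[(-1)%R, x + 1] (EFin \o f).
  apply: continuous_compact_integrable; first exact: segment_compact.
  exact: continuous_subspaceT.
have [] := @continuous_FTC1_closed _ f (-1) x (x + 1) xu fi x1 (fc x).
rewrite derive1E => Hd HE; split; [exact: Hd|exact: HE].
Qed.

(** Primitives are taken from 0 to the right and extended by 0 to the left, so that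
    all functions of the radius live on the whole line. *)
Lemma prim_exists : exists P : (R -> R) -> R -> R,
  forall f, [/\ forall x, x <= 0 -> P f x = 0,
    continuous f -> continuous (P f)
  & continuous f -> forall x, 0 < x -> has_deriv (P f) x (f x)].
Proof.
exists (fun f x => integral_from f (Num.max x 0) - integral_from f 0) => f.
split.
- by move=> x x0; rewrite max_r // subrr.
- move=> fc x.
  have H : {for x, continuous (fun t : R => integral_from f (Num.max t 0))}.
    apply: (@continuous_comp _ _ _ (fun t : R => Num.max t 0) (integral_from f)).
      by apply: continuous_max; [exact: cvg_id|exact: cvg_cst].
    apply: has_deriv_continuous (integral_from_deriv fc _).
    by rewrite lt_max ltrN10 orbT.
  exact: (continuous_add H (@continuous_cstE R R (- integral_from f 0) x)).
- move=> fc x x0.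
  apply: (has_deriv_gt0_eq (f := fun t => integral_from f t - integral_from f 0) x0).
    by move=> t t0; rewrite max_l // ltW.
  apply: has_deriv_eq.
    apply: has_derivB; last exact: has_deriv_cst.
    by apply: integral_from_deriv => //; apply: lt_trans x0; rewrite ltrN10.
  by rewrite subr0.
Qed.

(** Chosen from the existence statement so that conversion never unfolds the
    integral. *)
Definition prim : (R -> R) -> R -> R := sval (cid prim_exists).

Lemma prim_le0 (f : R -> R) (x : R) : x <= 0 -> prim f x = 0.
Proof. by have [H _ _] := svalP (cid prim_exists) f; exact: H. Qed.

Lemma prim_continuous (f : R -> R) : continuous f -> continuous (prim f).
Proof. by have [_ H _] := svalP (cid prim_exists) f. Qed.

Lemma prim_deriv (f : R -> R) (x : R) : continuous f -> 0 < x ->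
  has_deriv (prim f) x (f x).
Proof. by move=> fc x0; have [_ _ H] := svalP (cid prim_exists) f; exact: H. Qed.

(** This is the reason for the weight e^(la t): integration gains a factor 1 / la. *)
Lemma prim_dist_expR (f g : R -> R) (c la r : R) :
  continuous f -> continuous g -> 0 <= c ->
  (forall t, 0 < t < r -> `|f t - g t| <= c * (la * expR (la * t))) ->
  `|prim f r - prim g r| <= c * expR (la * `|r|).
Proof.
move=> fc gc c0 Hfg; have [r0|r0] := leP r 0.
  by rewrite !prim_le0 // subrr normr0 mulr_ge0 // expR_ge0.
pose F t := prim f t - prim g t; pose G t := c * expR (la * t).
have F0 : F 0 = 0 by rewrite /F !prim_le0 // subr0.
have G0 : 0 <= G 0 by rewrite mulr_ge0 // expR_ge0.
suff H : `|F r - F 0| <= G r - G 0.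
  rewrite (gtr0_norm r0); move: H; rewrite F0 subr0 => H.
  by apply: (le_trans H); rewrite gerBl.
apply: (@deriv_norm_le R F (fun t => f t - g t) G
  (fun t => c * (expR (la * t) * (la * 1))) 0 r (ltW r0)).
- move=> t _; apply: (@continuous_add R R (prim f) (fun t => - prim g t)).
    exact: prim_continuous.
  by apply: (@continuous_opp R R); exact: prim_continuous.
- move=> t _; apply: has_deriv_continuous; apply: has_derivZ.
  by apply: has_deriv_expR; apply: has_derivZ; exact: has_deriv_id.
- by move=> t /andP[t0 _]; apply: has_derivB; exact: prim_deriv.
- move=> t _; apply: has_derivZ; apply: has_deriv_expR; apply: has_derivZ.
  exact: has_deriv_id.
- by move=> t Ht; apply: (le_trans (Hfg t Ht)); rewrite mulr1 [la * _]mulrC.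
Qed.

Lemma prim_bounds (f : R -> R) (c r : R) : continuous f -> 0 <= r ->
  (forall t, 0 < t < r -> 0 <= f t <= c) -> 0 <= prim f r <= c * r.
Proof.
move=> fc r0 Hf; apply/andP; split.
  rewrite -(prim_le0 f (lexx 0)).
  apply: (@deriv_ndecr R (prim f) f) => //.
  - by move=> t _; exact: prim_continuous.
  - by move=> t /andP[t0 _]; exact: prim_deriv.
  - by move=> t /Hf/andP[].
pose F t := c * t - prim f t.
suff : F 0 <= F r by rewrite /F prim_le0 // mulr0 subr0 subr_ge0.
apply: (@deriv_ndecr R F (fun t => c * 1 - f t)) => //.
- move=> t _; apply: (@continuous_add R R (fun t => c * t) (fun t => - prim f t)).
    exact: has_deriv_continuous (has_derivZ c (has_deriv_id t)).
  by apply: (@continuous_opp R R); exact: prim_continuous.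
- move=> t /andP[t0 _]; apply: has_derivB; last exact: prim_deriv.
  exact: has_derivZ (has_deriv_id t).
- by move=> t /Hf/andP[_]; rewrite mulr1 subr_ge0.
Qed.

End Primitive.

Section VolterraFixpoint.
Context {R : realType}.
Implicit Types (S r s eps M : R) (y z : R -> R).

(** The intervals of centre a k and radius 2 C / 2^k are nested. *)
Lemma geometric_limit (a : nat -> R) (C : R) :
  (forall k, `|a k.+1 - a k| <= C / 2 ^+ k) ->
  forall k, `|limn a - a k| <= 2 * C / 2 ^+ k.
Proof.
move=> Ha.
have C0 : 0 <= C by have := Ha 0%N; rewrite expr0 divr1; apply: le_trans.
pose E k := C / 2 ^+ k.
have ES k : E k = 2 * E k.+1 by rewrite /E exprS; field; rewrite expf_neq0.
have E0 k : 0 <= E k by rewrite divr_ge0 // exprn_ge0.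
have {}Ha k : `|a k.+1 - a k| <= E k := Ha k.
have CE k : 2 * C / 2 ^+ k = 2 * E k by rewrite /E mulrA.
pose b k := a k - 2 * E k.
pose c k := a k + 2 * E k.
have bS k : b k <= b k.+1.
  by rewrite /b; have := Ha k; rewrite ler_norml => /andP[]; rewrite (ES k); lra.
have cS k : c k.+1 <= c k.
  by rewrite /c; have := Ha k; rewrite ler_norml => /andP[]; rewrite (ES k); lra.
have bm j k : (j <= k)%N -> b j <= b k.
  by move=> /subnK <-; elim: (k - j)%N => // m IH; rewrite addSn (le_trans IH).
have cm j k : (j <= k)%N -> c k <= c j.
  by move=> /subnK <-; elim: (k - j)%N => // m IH; rewrite addSn (le_trans _ IH).
have bc j k : b j <= c k.
  apply: (le_trans (bm _ _ (leq_maxl j k))); apply: (le_trans _ (cm _ _ (leq_maxr j k))).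
  by have := E0 (maxn j k); rewrite /b /c; lra.
pose l := sup (range b).
have bl k : b k <= l.
  apply: sup_upper_bound; last by exists k.
  by split; [exists (b 0%N); exists 0%N|exists (c 0%N) => _ [j _ <-]; exact: bc].
have lc k : l <= c k.
  by apply: ge_sup; [exists (b 0%N); exists 0%N|move=> _ [j _ <-]; exact: bc].
have lb k : `|l - a k| <= 2 * C / 2 ^+ k.
  by rewrite CE ler_norml; have := bl k; have := lc k; rewrite /b /c; lra.
suff al : a @ \oo --> l by rewrite (cvg_lim _ al).
have g0 : (fun k => 2 * C / 2 ^+ k) @ \oo --> (0 : R).
  have := @cvg_geometric R (2 * C) (2^-1).
  rewrite ger0_norm ?invr_ge0 // invf_lt1 // ltr1n => /(_ isT).
  by rewrite /geometric; under eq_fun do rewrite exprVn.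
apply/cvgrPdist_le => eps eps0.
have /cvgrPdist_le/(_ eps eps0) := g0.
apply: filterS => k; rewrite sub0r normrN => H.
exact: le_trans (lb k) (le_trans (ler_norm _) H).
Qed.

(** Picard iteration with Bielecki weights: on each interval [- S, S] the operator is
    a contraction of ratio 1/2 for the norm weighted by e^(- la |r|), for some la
    depending on S. The limit is pointwise, hence the same for all S. *)
Lemma volterra_fixpoint (T : (R -> R) -> R -> R) :
  (forall y, continuous y -> continuous (T y)) ->
  (forall S : R, exists B : R, forall y z, continuous y -> continuous z ->
     forall r, `|r| <= S -> `|T y r - T z r| <= B) ->
  (forall S : R, exists2 la : R, 0 <= la & forall y z M, continuous y -> continuous z ->
     0 <= M -> (forall r, `|r| <= S -> `|y r - z r| <= M * expR (la * `|r|)) ->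
     forall r, `|r| <= S -> `|T y r - T z r| <= M / 2 * expR (la * `|r|)) ->
  exists y, continuous y /\ forall r, T y r = y r.
Proof.
move=> Tc Tb Tl.
pose Y k := iter k T (T (fun=> 0)).
have Yc k : continuous (Y k).
  by elim: k => [|k IH]; apply: Tc => //; move=> x; exact: cvg_cst.
have geom S : exists B la : R, [/\ 0 <= B, 0 <= la,
    (forall k r, `|r| <= S -> `|Y k.+1 r - Y k r| <= B * expR (la * `|r|) / 2 ^+ k)
    & (forall y z M, continuous y -> continuous z ->
     0 <= M -> (forall r, `|r| <= S -> `|y r - z r| <= M * expR (la * `|r|)) ->
     forall r, `|r| <= S -> `|T y r - T z r| <= M / 2 * expR (la * `|r|))].
  have [B HB] := Tb S; have [la la0 Hla] := Tl S.
  exists (Num.max B 0), la.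
  have B0 : 0 <= Num.max B 0 by rewrite le_max lexx orbT.
  split => // k; elim: k => [|k IH] r rS.
    rewrite expr0 divr1; apply: (@le_trans _ _ (Num.max B 0)).
      have c0 : continuous (fun _ : R => 0 : R) by move=> x; exact: cvg_cst.
      by rewrite le_max (HB _ _ (Yc 0%N) c0 r rS).
    by rewrite ler_peMr // -expR0 ler_expR mulr_ge0.
  have -> : Num.max B 0 * expR (la * `|r|) / 2 ^+ k.+1
      = Num.max B 0 / 2 ^+ k / 2 * expR (la * `|r|).
    by rewrite exprS; field; rewrite expf_neq0.
  apply: (Hla _ _ _ (Yc k.+1) (Yc k)) => //; first by rewrite divr_ge0 ?exprn_ge0.
  by move=> s sS; rewrite mulrAC; exact: IH.
pose y r := limn (fun k => Y k r).
have yY S : exists B la : R, [/\ 0 <= B, 0 <= la,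
    (forall k r, `|r| <= S -> `|y r - Y k r| <= B / 2 ^+ k * expR (la * `|r|))
    & (forall y z M, continuous y -> continuous z ->
     0 <= M -> (forall r, `|r| <= S -> `|y r - z r| <= M * expR (la * `|r|)) ->
     forall r, `|r| <= S -> `|T y r - T z r| <= M / 2 * expR (la * `|r|))].
  have [B [la [B0 la0 HB Hla]]] := geom S.
  exists (2 * B), la; split => //; first by rewrite mulr_ge0.
  move=> k r rS; apply: le_trans (@geometric_limit (fun k => Y k r) (B * expR (la * `|r|)) _ k) _.
    by move=> j; exact: HB.
  by rewrite le_eqVlt; apply/orP; left; apply/eqP; ring.
have small (C eps : R) : 0 < eps -> exists k, C / 2 ^+ k < eps.
  move=> eps0.
  have g0 : (fun k => C / 2 ^+ k) @ \oo --> (0 : R).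
    have := @cvg_geometric R C (2^-1).
    rewrite ger0_norm ?invr_ge0 // invf_lt1 // ltr1n => /(_ isT).
    by rewrite /geometric; under eq_fun do rewrite exprVn.
  have /cvgrPdist_lt/(_ eps eps0) [k _ /(_ k (leqnn k))] := g0.
  rewrite /= sub0r normrN => H; exists k; exact: le_lt_trans (ler_norm _) H.
have yc : continuous y.
  move=> x; apply/cvgrPdist_lt => eps eps0.
  have [B [la [B0 la0 HB _]]] := yY (`|x| + 1).
  have e3 : 0 < eps / 3 by lra.
  have [k Hk] := small (B * expR (la * (`|x| + 1))) (eps / 3) e3.
  have HB' r : `|r| <= `|x| + 1 -> `|y r - Y k r| < eps / 3.
    move=> rS; apply: le_lt_trans (HB k r rS) _; apply: le_lt_trans Hk.
    by rewrite mulrAC ler_wpM2r ?invr_ge0 ?exprn_ge0 // ler_wpM2l // ler_expR ler_wpM2l.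
  have := Yc k x; move/cvgrPdist_lt/(_ (eps / 3) e3).
  have N1 : \forall t \near x, `|x - t| < 1 by exists 1 => //= t.
  move=> N2; near=> t.
  have t1 : `|t| <= `|x| + 1.
    have xt : `|x - t| < 1 by near: t.
    by rewrite -lerBlDl (le_trans (lerB_dist t x)) // distrC ltW.
  have H1 := HB' t t1.
  have H2 : `|y x - Y k x| < eps / 3 by apply: HB'; rewrite lerDl.
  have H3 : `|Y k x - Y k t| < eps / 3 by near: t.
  move: H1 H2 H3; rewrite !ltr_norml; lra.
exists y; split => // r.
have [B [la [B0 la0 HB Hla]]] := yY `|r|.
apply/eqP; rewrite -subr_eq0 -normr_le0; apply/ler_addgt0Pr => eps eps0; rewrite add0r.
have e2 : 0 < eps / 2 by lra.
have [k Hk] := small (B * expR (la * `|r|)) (eps / 2) e2.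
have H1 : `|T y r - Y k.+1 r| <= B / 2 ^+ k / 2 * expR (la * `|r|).
  apply: (Hla _ _ _ yc (Yc k)) => //; first by rewrite divr_ge0 ?exprn_ge0.
  by move=> s sS; exact: HB.
have H2 := HB k.+1 r (lexx _).
have E : B / 2 ^+ k.+1 * expR (la * `|r|) = B / 2 ^+ k / 2 * expR (la * `|r|).
  by rewrite exprS; field; rewrite expf_neq0.
have E2 : B / 2 ^+ k / 2 * expR (la * `|r|) = B * expR (la * `|r|) / 2 ^+ k / 2.
  by ring.
move: H1 H2 Hk; rewrite E E2; set c := _ / 2 ^+ k.
rewrite !ler_norml => /andP[H1 H2] /andP[H3 H4] H5; lra.
Unshelve. all: by end_near. Qed.

End VolterraFixpoint.

(** * From a profile to a solution *)

Section ProfileToSolution.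
Context {R : realType}.
Implicit Types (r t : R).

(** A function of the radius with a limit at 0 and continuous at positive radii
    extends continuously as an even function, the form in which the criterion for
    radial functions uses it. *)
Lemma continuous_even (g : R -> R) (l : R) : g 0 = l ->
  g t @[t --> 0^'+] --> l -> (forall r, 0 < r -> {for r, continuous g}) ->
  continuous (fun t : R => g `|t|).
Proof.
move=> g0 gl gc x; have [->|x0] := eqVneq x 0; last first.
  apply: (@continuous_comp _ _ _ (fun t : R => `|t|) g); first exact: norm_continuous.
  by apply: gc; rewrite normr_gt0.
apply/cvgrPdist_lt => eps eps0; rewrite normr0 g0.
have /cvgrPdist_lt/(_ eps eps0) [d /= d0 Hd] := gl.
exists d => // t /=; rewrite sub0r normrN => td.
have [->|t0] := eqVneq t 0; first by rewrite normr0 g0 subrr normr0.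
by apply: Hd; rewrite /= ?sub0r ?normrN ?normr_id // normr_gt0.
Qed.

(** Here phi = - w / r and psi = - f^p w^q - N phi, so that N phi + psi is the
    Laplacian by construction; the limit of w / r is the value that makes psi
    vanish at the origin. *)
Lemma profile_positive_solution (N : nat) (p q : R) (f w : R -> R) :
  (0 < N)%N -> 0 <= q ->
  continuous (fun t : R => f `|t|) -> continuous (fun t : R => w `|t|) ->
  w 0 = 0 -> (forall r, 0 <= r -> 0 < f r) -> (forall r, 0 <= r -> 0 <= w r) ->
  (forall r, 0 < r -> profile_ode p q (N%:R - 1) f w r) ->
  w r / r @[r --> 0^'+] --> f 0 `^ p * 0 `^ q / N%:R ->
  positive_solution p q (fun x : 'rV[R]_N => f (enorm x)).
Proof.
move=> N0 q0 fc wc w0 f0 w_ge0 ode lim0.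
have NR : N%:R != 0 :> R by rewrite pnatr_eq0 -lt0n.
(* The value at 0 is dictated by the equation there. *)
pose phi r := if r == 0 then - (f 0 `^ p * 0 `^ q / N%:R) else - (w r / r).
pose psi r := - (f r `^ p * w r `^ q) - N%:R * phi r.
have phipos r : 0 < r -> phi r = - (w r / r) by move=> r0; rewrite /phi gt_eqF.
have phic : continuous (fun t : R => phi `|t|).
  apply: (@continuous_even phi (- (f 0 `^ p * 0 `^ q / N%:R))).
  - by rewrite /phi eqxx.
  - apply: (@cvg_trans _ ((fun r => - (w r / r)) @ 0^'+)); last exact: cvgN.
    apply: near_eq_cvg; near=> r; rewrite phipos //; near: r; exact: nbhs_right_gt.
  - move=> r r0; have [_ dw] := ode r r0.
    have : has_deriv (fun t => - (w t * t^-1)) r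
       (- ((f r `^ p * w r `^ q - (N%:R - 1) * w r / r) * r^-1 + w r * (- 1 / r ^+ 2))).
      apply: has_derivN; apply: has_derivM => //.
      by apply: has_derivV; [rewrite gt_eqF|exact: has_deriv_id].
    move=> /(has_deriv_gt0_eq (g := phi) r0) H.
    by apply: (has_deriv_continuous (H _)) => t t0; rewrite phipos.
have psic : continuous (fun t : R => psi `|t|).
  move=> t; rewrite /psi.
  apply: (@continuous_add R R (fun s => - (f `|s| `^ p * w `|s| `^ q))
    (fun s => - (N%:R * phi `|s|))); apply: continuous_opp; apply: continuous_mul.
  - by apply: continuous_powR_gt0; [exact: f0|exact: fc].
  - have [<-|qn0] := eqVneq 0 q.
      rewrite (_ : (fun s => _) = fun=> 1); first exact: continuous_cstE.
      by apply/funext => s; rewrite powRr0.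
    apply: continuous_powR; last exact: wc.
      by rewrite lt_neqAle qn0.
    by move=> s; exact: w_ge0.
  - exact: continuous_cstE.
  - exact: phic.
have psi0 : psi 0 = 0.
  by rewrite /psi /phi eqxx w0; field.
apply: (@radial_positive_solution R N p q f phi psi) => //.
- move=> r r0; rewrite phipos //; have [df _] := ode r r0.
  by apply: has_deriv_eq df _; field; rewrite gt_eqF.
- move=> r r0; have [_ dw] := ode r r0.
  apply: (has_deriv_gt0_eq (f := fun t => - (w t * t^-1)) r0).
    by move=> t t0; rewrite phipos.
  apply: has_deriv_eq.
    apply: has_derivN; apply: has_derivM; first exact: dw.
    by apply: has_derivV; [rewrite gt_eqF|exact: has_deriv_id].
  by rewrite /psi phipos //; field; rewrite gt_eqF.
- move=> r r0; rewrite /psi.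
  have -> : `|phi r| * r = w r.
    have [->|rn0] := eqVneq r 0; first by rewrite w0 mulr0.
    have rp : 0 < r by rewrite lt_neqAle eq_sym rn0.
    rewrite phipos // normrN normrM normfV !ger0_norm ?w_ge0 //.
    by rewrite divfK.
  by ring.
Unshelve. all: by end_near. Qed.

End ProfileToSolution.

(** * Existence of a global profile *)

Section Existence.
Context {R : realType}.
Implicit Types (r s t S M : R) (y z : R -> R).

Context (p q n : R).
Hypothesis p_ge0 : 0 <= p.
Hypothesis q_ge0 : 0 <= q.
Hypothesis q_lt1 : q < 1.
Hypothesis n_ge1 : 1 <= n.

Let e : R := 1 - q.
Let d : R := n * e + 1.
Let kap : R := e / d.
Let n_gt0 : 0 < n. Proof. exact: lt_le_trans n_ge1. Qed.
Let e_gt0 : 0 < e. Proof. by rewrite subr_gt0. Qed.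
Let e_le1 : e <= 1. Proof. by rewrite gerBl. Qed.
Let ne_gt0 : 0 < n * e. Proof. exact: mulr_gt0. Qed.
Let d_gt0 : 0 < d. Proof. exact: addr_gt0. Qed.
Let kap_gt0 : 0 < kap. Proof. exact: divr_gt0. Qed.
Let kap_le1 : kap <= 1.
Proof. by rewrite ler_pdivrMr // mul1r (le_trans e_le1) // lerDr ltW. Qed.
Let eV_gt0 : 0 < e^-1. Proof. by rewrite invr_gt0. Qed.
Let eV_ge1 : 1 <= e^-1. Proof. by rewrite invf_ge1. Qed.

(** A solution lies below 1 = f(0), is at least 1/2 on [0, 1/2], and r^(n - 1) f will
    be nondecreasing, so that f(r) >= (1/2) (2 r)^(1 - n) for r >= 1/2. The barrier
    is smaller than both bounds, by the factor 1/2 and by the shift. *)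
Definition barrier r := 4^-1 * (1 + 2 * `|r|) `^ (1 - n).

Let base_gt0 r : 0 < 1 + 2 * `|r|.
Proof. by rewrite ltr_wpDr // mulr_ge0. Qed.

Let barrier_gt0 r : 0 < barrier r.
Proof. by rewrite mulr_gt0 ?invr_gt0 // powR_gt0. Qed.

Let barrier_le r s : `|r| <= `|s| -> barrier s <= barrier r.
Proof.
move=> rs; rewrite ler_wpM2l ?invr_ge0 //; apply: powR_nincr => //.
  by rewrite subr_le0.
by rewrite lerD2l ler_wpM2l.
Qed.

Let barrier_le1 r : barrier r <= 4^-1.
Proof.
apply: le_trans (barrier_le (r := 0) _) _; first by rewrite normr0.
by rewrite /barrier normr0 mulr0 addr0 powR1 mulr1.
Qed.

Let barrier_continuous : continuous barrier.
Proof.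
move=> r; apply: (@continuous_mul R R (fun=> 4^-1) (fun t => (1 + 2 * `|t|) `^ (1 - n))).
  exact: continuous_cstE.
apply: (@continuous_powR_gt0 R R (fun t => 1 + 2 * `|t|)) => //.
apply: continuous_add; first exact: continuous_cstE.
apply: (@continuous_mul R R (fun=> 2)); first exact: continuous_cstE.
exact: norm_continuous.
Qed.

Definition clamp r t := Num.min 1 (Num.max t (barrier r)).

Let clamp_bounds r t : barrier r <= clamp r t <= 1.
Proof.
rewrite /clamp ge_min lexx /= andbT le_min le_max lexx orbT andbT.
by apply: le_trans (barrier_le1 r) _; rewrite invf_le1 // ler1n.
Qed.

Let clamp_gt0 r t : 0 < clamp r t.
Proof. by have /andP[H _] := clamp_bounds r t; exact: lt_le_trans H. Qed.

Let clamp_id r t : barrier r <= t <= 1 -> clamp r t = t.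
Proof. by move=> /andP[H1 H2]; rewrite /clamp max_l // min_r. Qed.

Let clamp_lipschitz r s t : `|clamp r s - clamp r t| <= `|s - t|.
Proof.
have H1 := ler_norm (s - t); have H2 := ler_norm (t - s).
rewrite distrC in H2; have H0 := normr_ge0 (s - t).
have H3 := barrier_le1 r.
rewrite /clamp /Order.min /Order.max ler_norml.
case: (ltP s (barrier r)) => ?; case: (ltP t (barrier r)) => ?;
  case: (ltP 1 (barrier r)) => ?; case: (ltP 1 s) => ?; case: (ltP 1 t) => ?;
  by apply/andP; split; lra.
Qed.

Let clamp_continuous y : continuous y -> continuous (fun r => clamp r (y r)).
Proof.
move=> yc r.
apply: (@continuous_min R R (fun=> 1) (fun r => Num.max (y r) (barrier r)) r).
  exact: cvg_cst.
by apply: (@continuous_max R R y barrier r); [exact: yc|exact: barrier_continuous].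
Qed.

(** The source f^p, truncated so as to be a Lipschitz function of f locally
    uniformly in r, even for p < 1, and bounded by 1. *)
Definition source y r := clamp r (y r) `^ p.

Let source_bounds y r : 0 < source y r <= 1.
Proof.
rewrite powR_gt0 //=; have /andP[_ H] := clamp_bounds r (y r).
by have := powR_ndecr p_ge0 (ltW (clamp_gt0 r (y r))) H; rewrite powR1.
Qed.

Let source_continuous y : continuous y -> continuous (source y).
Proof.
move=> yc r; apply: (@continuous_powR_gt0 R R (fun r => clamp r (y r))) => //.
exact: clamp_continuous.
Qed.

(** The flux, the slope and the profile that correspond to the source built on y;
    a fixed point of picard solves the truncated problem with value 1 at 0. *)
Definition flux_of y := prim (fun r => e * (`|r| `^ (n * e) * source y r)).

Definition slope_of y r := flux_of y r `^ e^-1 / `|r| `^ n.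

Definition picard y r := 1 - prim (slope_of y) r.

Let integrand_continuous y : continuous y ->
  continuous (fun r => e * (`|r| `^ (n * e) * source y r)).
Proof.
move=> yc r.
apply: (@continuous_mul R R (fun=> e) (fun r => `|r| `^ (n * e) * source y r)).
  exact: continuous_cstE.
apply: (@continuous_mul R R (fun t => `|t| `^ (n * e)) (source y)).
  exact: continuous_powR_norm.
exact: source_continuous.
Qed.

Let flux_of_continuous y : continuous y -> continuous (flux_of y).
Proof. by move=> yc; apply: prim_continuous; exact: integrand_continuous. Qed.

Let flux_of_le0 y r : r <= 0 -> flux_of y r = 0.
Proof. exact: prim_le0. Qed.

Let flux_of_deriv y r : continuous y -> 0 < r ->
  has_deriv (flux_of y) r (e * (r `^ (n * e) * source y r)).
Proof.
move=> yc r0; have := prim_deriv (integrand_continuous yc) r0.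
by rewrite gtr0_norm.
Qed.

Let radius_deriv (c : R) r : 0 < r ->
  has_deriv (fun t => c * `|t| `^ d) r (c * d * r `^ (n * e)).
Proof.
move=> r0; apply: (has_deriv_gt0_eq (f := fun t => c * t `^ d) r0).
  by move=> t t0; rewrite gtr0_norm.
apply: has_deriv_eq; first exact: has_derivZ (has_deriv_powR _ r0 (has_deriv_id r)).
by rewrite /= /d addrK; ring.
Qed.

Let radius_continuous (c : R) : continuous (fun t : R => c * `|t| `^ d).
Proof.
move=> t; apply: (@continuous_mul R R (fun=> c) (fun t => `|t| `^ d)).
  exact: continuous_cstE.
exact: continuous_powR_norm.
Qed.

(** Comparison with kap c r^d, the flux of a constant source c. *)
Let flux_of_ge y (c : R) r : continuous y -> 0 <= r ->
  (forall t, 0 < t < r -> c <= source y t) -> kap * c * r `^ d <= flux_of y r.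
Proof.
move=> yc r0 Hc.
pose F t := flux_of y t - kap * c * `|t| `^ d.
have : F 0 <= F r.
  apply: (@deriv_ndecr R F
    (fun t => e * (t `^ (n * e) * (source y t - c)))); first exact: r0.
  - move=> t _; apply: (@continuous_add R R (flux_of y) (fun t => - (kap * c * `|t| `^ d))).
      exact: flux_of_continuous.
    by apply: (@continuous_opp R R); exact: radius_continuous.
  - move=> t /andP[t0 _]; apply: has_deriv_eq.
      by apply: has_derivB; [exact: flux_of_deriv|exact: radius_deriv].
    by rewrite /kap; field; rewrite gt_eqF.
  - move=> t H; rewrite mulr_ge0 ?(ltW e_gt0) // mulr_ge0 ?powR_ge0 //.
    by rewrite subr_ge0; exact: Hc.
by rewrite /F flux_of_le0 // normr0 powR0 ?gt_eqF // mulr0 subr0 ger0_norm // subr_ge0.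
Qed.

Let flux_of_dist y z (c : R) r : continuous y -> continuous z -> 0 <= r ->
  (forall t, 0 < t < r -> `|source y t - source z t| <= c) ->
  `|flux_of y r - flux_of z r| <= kap * c * r `^ d.
Proof.
move=> yc zc r0 Hc.
have := @deriv_norm_le R (fun t => flux_of y t - flux_of z t)
  (fun t => e * (t `^ (n * e) * source y t) - e * (t `^ (n * e) * source z t))
  (fun t => kap * c * `|t| `^ d) (fun t => kap * c * d * t `^ (n * e)) 0 r r0.
rewrite !(flux_of_le0 _ (lexx 0)) !subr0 normr0 powR0 ?gt_eqF // mulr0 subr0.
rewrite (ger0_norm r0); apply.
- move=> t _; apply: (@continuous_add R R (flux_of y) (fun t => - flux_of z t)).
    exact: flux_of_continuous.
  by apply: (@continuous_opp R R); exact: flux_of_continuous.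
- by move=> t _; exact: radius_continuous.
- by move=> t /andP[t0 _]; apply: has_derivB; exact: flux_of_deriv.
- by move=> t /andP[t0 _]; exact: radius_deriv.
- move=> t H; rewrite -mulrBr -mulrBr normrM normrM (ger0_norm (ltW e_gt0)).
  rewrite ger0_norm ?powR_ge0 // (_ : kap * c * d * _ = e * (t `^ (n * e) * c)).
    by rewrite ler_wpM2l ?(ltW e_gt0) // ler_wpM2l ?powR_ge0 // Hc.
  by rewrite /kap; field; rewrite gt_eqF.
Qed.

Let flux_of_ge0 y r : continuous y -> 0 <= flux_of y r.
Proof.
move=> yc; have [r0|r0] := leP 0 r; last by rewrite flux_of_le0 // ltW.
have := @flux_of_ge y 0 r yc r0; rewrite mulr0 mul0r; apply => t _.
by have /andP[/ltW] := source_bounds y t.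
Qed.

Let flux_of_gt0 y r : continuous y -> 0 < r -> 0 < flux_of y r.
Proof.
move=> yc r0; have b0 : 0 < barrier r `^ p by rewrite powR_gt0.
apply: lt_le_trans (@flux_of_ge y (barrier r `^ p) r yc (ltW r0) _).
  by rewrite mulr_gt0 ?powR_gt0 // mulr_gt0.
move=> t /andP[t0 tr]; apply: powR_ndecr => //; first exact: ltW.
have /andP[H _] := clamp_bounds t (y t); apply: le_trans H.
by apply: barrier_le; rewrite !gtr0_norm ?ltW.
Qed.

Let flux_of_le y r : continuous y -> 0 <= r -> flux_of y r <= kap * r `^ d.
Proof.
move=> yc r0.
pose F t := - (flux_of y t - kap * 1 * `|t| `^ d).
have : F 0 <= F r.
  apply: (@deriv_ndecr R F
    (fun t => e * (t `^ (n * e) * (1 - source y t)))); first exact: r0.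
  - move=> t _; apply: (@continuous_opp R R).
    apply: (@continuous_add R R (flux_of y) (fun t => - (kap * 1 * `|t| `^ d))).
      exact: flux_of_continuous.
    by apply: (@continuous_opp R R); exact: radius_continuous.
  - move=> t /andP[t0 _]; apply: has_deriv_eq.
      by apply: has_derivN; apply: has_derivB; [exact: flux_of_deriv|exact: radius_deriv].
    by rewrite /kap; field; rewrite gt_eqF.
  - move=> t H; rewrite mulr_ge0 ?(ltW e_gt0) // mulr_ge0 ?powR_ge0 //.
    by rewrite subr_ge0; have /andP[] := source_bounds y t.
rewrite /F flux_of_le0 // normr0 powR0 ?gt_eqF // mulr0 subr0 ger0_norm // mulr1.
by rewrite oppr0 oppr_ge0 subr_le0.
Qed.

(** The slope is the power 1/e >= 1 of this quotient, which stays bounded near 0: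
    the Lipschitz bound of the slope is obtained through it. *)
Let dens y r := flux_of y r / r `^ (n * e).

Let slope_ofE y r : continuous y -> 0 < r -> slope_of y r = dens y r `^ e^-1.
Proof.
move=> yc r0; rewrite /slope_of /dens gtr0_norm // powRM ?flux_of_ge0 ?invr_ge0 ?powR_ge0 //.
rewrite -!powRN -powRrM; congr (_ * _ `^ _).
by field; rewrite gt_eqF.
Qed.

Let dens_bounds y r : continuous y -> 0 < r -> 0 <= dens y r <= kap * r.
Proof.
move=> yc r0; rewrite /dens divr_ge0 ?flux_of_ge0 ?powR_ge0 //=.
rewrite ler_pdivrMr ?powR_gt0 // -mulrA [r * _]mulrC -powRD1 //.
by apply: flux_of_le => //; exact: ltW.
Qed.

Let slope_of_le0 y r : r <= 0 -> slope_of y r = 0.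
Proof. by move=> r0; rewrite /slope_of flux_of_le0 // powR0 ?mul0r // gt_eqF. Qed.

Let slope_of_ge0 y r : 0 <= slope_of y r.
Proof. by rewrite divr_ge0 ?powR_ge0. Qed.

Let slope_of_gt0 y r : continuous y -> 0 < r -> 0 < slope_of y r.
Proof. by move=> yc r0; rewrite divr_gt0 // powR_gt0 ?flux_of_gt0 // normr_gt0 gt_eqF. Qed.

Let slope_of_le y r : continuous y -> 0 <= r -> slope_of y r <= (kap * r) `^ e^-1.
Proof.
move=> yc; rewrite le_eqVlt => /predU1P[<-|r0]; first by rewrite slope_of_le0 ?powR_ge0.
have /andP[H1 H2] := dens_bounds yc r0.
by rewrite slope_ofE //; apply: powR_ndecr => //; exact: ltW.
Qed.

Let slope_of_continuous y : continuous y -> continuous (slope_of y).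
Proof.
move=> yc r; have [->|r0] := eqVneq r 0; last first.
  apply: (@continuous_mul R R (fun t => flux_of y t `^ e^-1) (fun t => (`|t| `^ n)^-1)).
    apply: continuous_powR => //; first by move=> t; exact: flux_of_ge0.
    exact: flux_of_continuous.
  apply: continuous_inv; first by rewrite powR_eq0 normr_eq0 (negbTE r0).
  exact: continuous_powR_norm.
apply/cvgrPdist_lt => eps eps0; rewrite slope_of_le0 //.
have := @continuous_powR_norm R _ eV_gt0 0.
move=> /cvgrPdist_lt/(_ eps eps0); apply: filterS => t.
rewrite normr0 powR0 ?gt_eqF // !sub0r !normrN => H.
rewrite ger0_norm ?slope_of_ge0 //; move: H; rewrite ger0_norm ?powR_ge0 // => H.
have [t0|t0] := leP t 0; first by rewrite slope_of_le0.
apply: le_lt_trans (slope_of_le yc (ltW t0)) _; apply: le_lt_trans H.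
rewrite gtr0_norm //; apply: powR_ndecr; rewrite ?(ltW eV_gt0) //.
  by rewrite mulr_ge0 // ltW.
by rewrite ler_piMl // ltW.
Qed.

Let picard_continuous y : continuous y -> continuous (picard y).
Proof.
move=> yc r; apply: (@continuous_add R R (fun=> 1) (fun t => - prim (slope_of y) t)).
  exact: continuous_cstE.
apply: (@continuous_opp R R); apply: prim_continuous; exact: slope_of_continuous.
Qed.

Let dist_le_bound (a b B : R) : 0 <= a <= B -> 0 <= b <= B -> `|a - b| <= B.
Proof. by move=> /andP[? ?] /andP[? ?]; rewrite ler_norml; apply/andP; split; lra. Qed.

Let prim_slope_of_bounds y S : continuous y ->
  forall r, r <= S -> 0 <= prim (slope_of y) r <= Num.max S 0 `^ e^-1 * Num.max S 0.
Proof.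
move=> yc r rS; set m := Num.max S 0.
have m0 : 0 <= m by rewrite le_max lexx orbT.
have [r0|r0] := leP r 0; first by rewrite prim_le0 // lexx mulr_ge0 // powR_ge0.
have rm : r <= m by rewrite le_max rS.
have := @prim_bounds R (slope_of y) (m `^ e^-1) r (slope_of_continuous yc) (ltW r0).
case/(_ _)/andP => [t /andP[t0 tr]|-> /= H].
  rewrite slope_of_ge0 /=.
  apply: le_trans (slope_of_le yc (ltW t0)) _; apply: powR_ndecr; first exact: ltW.
    by rewrite mulr_ge0 // ltW.
  apply: (@le_trans _ _ t); first by rewrite ler_piMl // ltW.
  by rewrite (le_trans (ltW tr)).
by apply: le_trans H _; rewrite ler_wpM2l ?powR_ge0.
Qed.

Let picard_le1 y r : continuous y -> picard y r <= 1.
Proof.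
move=> yc; have /andP[H _] := prim_slope_of_bounds yc (lexx r).
by rewrite /picard gerBl.
Qed.

Let picard_half y r : continuous y -> r <= 2^-1 -> 2^-1 <= picard y r.
Proof.
move=> yc r2; have /andP[_] := prim_slope_of_bounds yc r2.
have h0 : 0 < (2 : R)^-1 by rewrite invr_gt0.
rewrite max_l ?(ltW h0) // => H.
have : (2 : R)^-1 `^ e^-1 <= 1.
  have := @powR_ndecr R e^-1 2^-1 1 (ltW eV_gt0) (ltW h0); rewrite powR1; apply.
  by rewrite invf_le1 // ler1n.
rewrite /picard => H2.
have : (2 : R)^-1 `^ e^-1 * 2^-1 <= 1 * 2^-1 by rewrite ler_wpM2r // ltW.
lra.
Qed.

Let source_lipschitz S : exists2 L : R, 0 <= L & forall y z r, `|r| <= S ->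
  `|source y r - source z r| <= L * `|y r - z r|.
Proof.
(* The summand barrier S `^ (p - 1) serves for p < 1, and 1 for p >= 1. *)
pose L := p * (barrier S `^ (p - 1) + 1).
have L0 : 0 <= L by rewrite mulr_ge0 // addr_ge0 // powR_ge0.
exists L => // y z r rS.
have bS : barrier S <= barrier r by apply: barrier_le; rewrite (le_trans rS) // ler_norm.
apply: (@le_trans _ _ (L * `|clamp r (y r) - clamp r (z r)|)); last first.
  by rewrite ler_wpM2l // clamp_lipschitz.
have cb u : barrier S <= clamp r u <= 1.
  by have /andP[H1 H2] := clamp_bounds r u; rewrite (le_trans bS).
apply: (@powR_lipschitz R p L (barrier S) 1 p_ge0 (ltW (barrier_gt0 S))) => //.
move=> t /andP[t0 t1]; rewrite ler_wpM2l //.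
have tp : 0 < t := lt_trans (barrier_gt0 S) t0.
have [p1|p1] := leP 0 (p - 1).
  have := powR_ndecr p1 (ltW tp) t1; rewrite powR1 => H.
  by rewrite (le_trans H) // lerDr powR_ge0.
have := powR_nincr (ltW p1) (barrier_gt0 S) (ltW t0) => H.
by rewrite (le_trans H) // lerDl.
Qed.

(** The difference of the fluxes is at most kap L M e^(la t) t^d, and the power 1/e is
    Lipschitz on [0, S] because 1/e >= 1. *)
Let slope_of_lipschitz S : exists2 L1 : R, 0 <= L1 &
  forall y z M la, continuous y -> continuous z -> 0 <= M -> 0 <= la ->
    (forall r, `|r| <= S -> `|y r - z r| <= M * expR (la * `|r|)) ->
    forall t, 0 < t <= S -> `|slope_of y t - slope_of z t| <= L1 * (M * expR (la * t)).
Proof.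
have [L L0 HL] := source_lipschitz S.
have [S0|S0] := leP S 0.
  exists 0 => // y z M la _ _ _ _ _ t /andP[t0 tS].
  by have := lt_le_trans t0 (le_trans tS S0); rewrite ltxx.
exists (e^-1 * S `^ (e^-1 - 1) * (L * S)).
  by rewrite !mulr_ge0 ?powR_ge0 // ltW.
move=> y z M la yc zc M0 la0 Hyz t /andP[t0 tS].
have mdist : `|dens y t - dens z t| <= L * S * (M * expR (la * t)).
  rewrite /dens -mulrBl normrM normfV [`|_ `^ _|]ger0_norm ?powR_ge0 //.
  have X0 : 0 < t `^ (n * e) by rewrite powR_gt0.
  rewrite ler_pdivrMr //.
  apply: (@le_trans _ _ (kap * (L * (M * expR (la * t))) * t `^ d)).
    apply: flux_of_dist => //; first exact: ltW.
    move=> s /andP[s0 st]; have sS : `|s| <= S.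
      by rewrite gtr0_norm // (le_trans (ltW st)).
    apply: (le_trans (HL y z s sS)); rewrite ler_wpM2l //.
    apply: (le_trans (Hyz s sS)); rewrite ler_wpM2l // ler_expR ler_wpM2l //.
    by rewrite gtr0_norm // ltW.
  have -> : t `^ d = t `^ (n * e) * t by rewrite powRD1.
  set E := M * expR (la * t); have E0 : 0 <= E by rewrite mulr_ge0 ?expR_ge0.
  have -> : kap * (L * E) * (t `^ (n * e) * t) = (kap * t) * (L * E * t `^ (n * e)) by ring.
  have -> : L * S * E * t `^ (n * e) = S * (L * E * t `^ (n * e)) by ring.
  rewrite ler_wpM2r //; first by rewrite !mulr_ge0 // ltW.
  apply: (@le_trans _ _ t); last exact: tS.
  by rewrite ler_piMl // ltW.
rewrite !slope_ofE //.
have db u : continuous u -> 0 <= dens u t <= S.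
  move=> uc; have /andP[H1 H2] := dens_bounds uc t0; rewrite H1 /=.
  apply: (le_trans H2); apply: (@le_trans _ _ t) => //.
  by rewrite ler_piMl // ltW.
apply: (@le_trans _ _ (e^-1 * S `^ (e^-1 - 1) * `|dens y t - dens z t|)).
  apply: (@powR_lipschitz R e^-1 _ 0 S) => //; [exact: ltW| |exact: db|exact: db].
  move=> s /andP[s0 sS]; rewrite ler_wpM2l ?(ltW eV_gt0) //.
  by apply: powR_ndecr; rewrite ?subr_ge0 // ltW.
rewrite -[leRHS]mulrA ler_wpM2l //.
by rewrite mulr_ge0 ?powR_ge0 // ltW.
Qed.

Let picard_contraction S : exists2 la : R, 0 <= la &
  forall y z M, continuous y -> continuous z -> 0 <= M ->
    (forall r, `|r| <= S -> `|y r - z r| <= M * expR (la * `|r|)) ->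
    forall r, `|r| <= S -> `|picard y r - picard z r| <= M / 2 * expR (la * `|r|).
Proof.
have [L1 L10 HL1] := slope_of_lipschitz S.
have [la laE] : exists la, la = 2 * L1 by exists (2 * L1).
have la0 : 0 <= la by rewrite laE mulr_ge0.
exists la => // y z M yc zc M0 Hyz r rS.
have M20 : 0 <= M / 2 by rewrite divr_ge0.
rewrite /picard opprB addrC addrA subrK.
apply: (@prim_dist_expR R (slope_of z) (slope_of y) (M / 2) la r) => //;
  [exact: slope_of_continuous|exact: slope_of_continuous|].
move=> t /andP[t0 tr]; rewrite distrC.
have rp := lt_trans t0 tr.
apply: (le_trans (HL1 y z M la yc zc M0 la0 Hyz t _)).
  by rewrite t0 ltW // (lt_le_trans tr) // -(gtr0_norm rp).
by rewrite laE le_eqVlt; apply/orP; left; apply/eqP; field.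
Qed.

Lemma picard_fixpoint : exists y, continuous y /\ forall r, picard y r = y r.
Proof.
apply: volterra_fixpoint => [y yc|S|S]; first exact: picard_continuous.
  pose m := Num.max S 0; exists (m `^ e^-1 * m) => y z yc zc r rS.
  have rS' : r <= S := le_trans (ler_norm r) rS.
  rewrite /picard opprB addrC addrA subrK.
  exact: dist_le_bound (prim_slope_of_bounds zc rS') (prim_slope_of_bounds yc rS').
exact: picard_contraction.
Qed.


Context (y : R -> R).
Hypothesis yc : continuous y.
Hypothesis yT : forall r, picard y r = y r.
Let w := slope_of y.

Let y_deriv r : 0 < r -> has_deriv y r (- w r).
Proof.
move=> r0; rewrite (_ : y = fun t => 1 - prim (slope_of y) t); last first.
  by apply/funext => t; rewrite -{1}yT.
apply: has_deriv_eq.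
  apply: has_derivB; first exact: has_deriv_cst.
  by apply: prim_deriv => //; exact: slope_of_continuous.
by rewrite sub0r.
Qed.

Let y_le1 r : y r <= 1. Proof. by rewrite -yT; exact: picard_le1. Qed.

Let w_gt0 r : 0 < r -> 0 < w r. Proof. exact: slope_of_gt0. Qed.

Let flux_slope_of r : 0 < r -> flux q n w r = flux_of y r.
Proof.
move=> r0; have X0 : 0 < r `^ (n * e) by rewrite powR_gt0.
have /andP[D0 _] := dens_bounds yc r0.
rewrite /flux -/e /w slope_ofE // -powRrM mulVf ?gt_eqF // powRr1 //.
by rewrite /dens mulrC divfK // gt_eqF.
Qed.

Let slope_of_deriv r : 0 < r -> has_deriv w r (source y r * w r `^ q - n * w r / r).
Proof.
move=> r0; apply: (has_deriv_gt0_eq (f := fun t => flux_of y t `^ e^-1 * (t `^ n)^-1) r0).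
  by move=> t t0; rewrite /w /slope_of gtr0_norm.
have m0 := flux_of_gt0 yc r0; have X0 : 0 < r `^ n by rewrite powR_gt0.
apply: has_deriv_eq.
  apply: has_derivM.
    exact: has_deriv_powR _ m0 (flux_of_deriv yc r0).
  apply: has_derivV; first by rewrite gt_eqF.
  exact: has_deriv_powR _ r0 (has_deriv_id r).
have wE : flux_of y r `^ e^-1 = w r * r `^ n.
  by rewrite /w /slope_of gtr0_norm // divfK // gt_eqF.
have mE : flux_of y r = r `^ (n * e) * w r `^ e by rewrite -flux_slope_of.
have E : w r `^ e * w r `^ q = w r.
  by rewrite /e -powRD ?subrK ?powRr1 ?ltW ?w_gt0 // (gt_eqF (w_gt0 r0)) implybT.
rewrite /= !powRB1 // wE mE.
have e0 : 0 < w r `^ e by rewrite powR_gt0 ?w_gt0.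
have Y0 : 0 < r `^ (n * e) by rewrite powR_gt0.
have -> : w r `^ q = w r / w r `^ e by rewrite -{2}E mulrC mulKf // gt_eqF.
by field; rewrite !gt_eqF.
Qed.

Let ode_above r : 0 < r -> barrier r <= y r -> profile_ode p q n y w r.
Proof.
move=> r0 br; split; first exact: y_deriv.
by have := slope_of_deriv r0; rewrite /source clamp_id // br y_le1.
Qed.

Hypothesis supercritical : d / (p + 1) <= (n - 1) * e / (1 + e).
Let p1_gt0 : 0 < p + 1. Proof. by rewrite ltr_wpDl. Qed.
Let eE : 2 - q = 1 + e. Proof. by rewrite /e; ring. Qed.
Let e1_gt0 : 0 < 1 + e. Proof. by rewrite addr_gt0. Qed.

Let y_gt0 r : barrier r <= y r -> 0 < y r.
Proof. exact: lt_le_trans. Qed.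

(** The Pohozaev function does not increase, and it is bounded by a function g
    tending to 0 at the origin. *)
Lemma pohozaev_le0 T : (forall t, 0 < t < T -> barrier t <= y t) ->
  forall r, 0 < r < T -> pohozaev p q n y w r <= 0.
Proof.
move=> HT r /andP[r0 rT].
have D t : 0 < t <= r -> has_deriv (pohozaev p q n y w) t
    (e * (d / (p + 1) - (n - 1) * e / (1 + e)) * (t `^ (n * e) * y t `^ (p + 1))).
  move=> /andP[t0 tr]; have bt : barrier t <= y t by apply: HT; rewrite t0 (le_lt_trans tr).
  have := pohozaev_deriv t0 (w_gt0 t0) (y_gt0 bt) q_lt1 p1_gt0 (ode_above t0 bt).
  by rewrite -/e eE.
have decr t : 0 < t < r -> pohozaev p q n y w r <= pohozaev p q n y w t.
  move=> /andP[t0 tr]; rewrite -lerN2.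
  apply: (@deriv_ndecr R (fun s => - pohozaev p q n y w s)
    (fun s => - (e * (d / (p + 1) - (n - 1) * e / (1 + e)) * (s `^ (n * e) * y s `^ (p + 1))))).
  - exact: ltW.
  - move=> s /andP[ts sr]; apply: (@continuous_opp R R).
    apply: (@has_deriv_continuous R (pohozaev p q n y w)).
    by apply: D; rewrite sr (lt_le_trans t0).
  - move=> s /andP[ts sr]; apply: has_derivN; apply: D.
    by rewrite (lt_trans t0) ?ltW.
  - move=> s _; rewrite oppr_ge0 mulr_le0_ge0 ?mulr_ge0 ?powR_ge0 //.
    by rewrite mulr_ge0_le0 ?(ltW e_gt0) // subr_le0.
pose g t := e / (2 - q) * (t * w t * flux_of y t) + e / (p + 1) * `|t| `^ d.
have gc : {for (0 : R), continuous g}.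
  apply: (@continuous_add R R (fun t => e / (2 - q) * (t * w t * flux_of y t))
    (fun t => e / (p + 1) * `|t| `^ d)); last exact: radius_continuous.
  apply: (@continuous_mul R R (fun=> e / (2 - q)) (fun t => t * w t * flux_of y t)).
    exact: continuous_cstE.
  apply: (@continuous_mul R R (fun t => t * w t) (flux_of y)); last exact: flux_of_continuous.
  apply: (@continuous_mul R R id w); first exact: cvg_id.
  exact: slope_of_continuous.
have := right_limit_ge r0 gc.
rewrite [g 0]/g flux_of_le0 // mulr0 mulr0 normr0 powR0 ?gt_eqF // mulr0 add0r; apply.
move=> t /andP[t0 tr]; apply: le_trans (decr t _) _; first by rewrite t0.
have bt : barrier t <= y t by apply: HT; rewrite t0 (lt_trans tr).
have y0 := y_gt0 bt.
rewrite /pohozaev flux_slope_of // -/e -/d /g gtr0_norm //; apply: lerD.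
  rewrite -mulrA ler_wpM2l //; first by rewrite divr_ge0 ?eE // ltW.
  rewrite ler_wpM2r ?flux_of_ge0 // gerBl mulr_ge0 ?subr_ge0 //; exact: ltW.
rewrite ler_wpM2l ?divr_ge0 ?(ltW e_gt0) ?(ltW p1_gt0) // ler_piMr ?powR_ge0 //.
have := @powR_ndecr R (p + 1) (y t) 1 (ltW p1_gt0) (ltW y0) (y_le1 t).
by rewrite powR1.
Qed.

(** The second summand of the Pohozaev function being nonnegative, the first one,
    which has the sign of r w - (n - 1) y, cannot be positive. *)
Lemma slope_le_above T : (forall t, 0 < t < T -> barrier t <= y t) ->
  forall r, 0 < r < T -> r * w r <= (n - 1) * y r.
Proof.
move=> HT r Hr; have := pohozaev_le0 HT Hr; have /andP[r0 rT] := Hr.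
rewrite /pohozaev flux_slope_of // -/e => P0; rewrite leNgt; apply/negP => H.
have : 0 < e / (2 - q) * (r * w r - (n - 1) * y r) * flux_of y r.
  by rewrite mulr_gt0 ?flux_of_gt0 // mulr_gt0 ?subr_gt0 // divr_gt0 // eE.
have : 0 <= e / (p + 1) * (r `^ (n * e + 1) * y r `^ (p + 1)).
  apply: mulr_ge0; first by rewrite divr_ge0 ?(ltW e_gt0) ?(ltW p1_gt0).
  by rewrite mulr_ge0 ?powR_ge0.
lra.
Qed.

(** At a first contact radius T >= 1/2 the monotonicity of t^(n - 1) y on [1/2, T]
    gives T^(n - 1) y(T) >= (1/2)^(n - 1) / 2, whereas T^(n - 1) barrier(T) is at most
    half of this. *)
Lemma above_barrier r : 0 <= r -> barrier r < y r.
Proof.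
move=> r_ge0; rewrite ltNge; apply/negP => Hr.
have half t : t <= 2^-1 -> 2^-1 <= y t by move=> H; rewrite -yT; exact: picard_half.
(* inf E is the first contact radius. *)
pose E := [set t | 0 <= t /\ y t <= barrier t]%classic.
have Er : E r by split.
have Ei : has_inf E by split; [exists r|exists 0 => t []].
pose T := inf E.
have T2 : 2^-1 <= T.
  apply: lb_le_inf; [by exists r|] => t [t0 Ht]; rewrite leNgt; apply/negP => tl.
  have := half t (ltW tl); have := barrier_le1 t; lra.
have h0 : 0 < (2 : R)^-1 by rewrite invr_gt0.
have T0 : 0 < T := lt_le_trans h0 T2.
have HT t : 0 < t < T -> barrier t <= y t.
  move=> /andP[t0 tT]; rewrite leNgt; apply/negP => H.
  have : E t by split; exact: ltW.
  by move=> /(ge_inf Ei.2); rewrite leNgt tT.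
have yT' : y T <= barrier T.
  rewrite leNgt; apply/negP => H.
  have gc : {for T, continuous (fun t => y t - barrier t)}.
    apply: (@continuous_add R R y (fun t => - barrier t)); first exact: yc.
    by apply: (@continuous_opp R R); exact: barrier_continuous.
  have [eps /= eps0 Heps] : \forall t \near T, 0 < y t - barrier t.
    by apply: (cvgr_gt _ gc); rewrite subr_gt0.
  have : T < T + eps by rewrite ltrDl.
  move=> /(inf_lt Ei.1)[t [t0 Ht] tT].
  have Tt : T <= t by apply: (ge_inf Ei.2).
  have : 0 < y t - barrier t.
    by apply: Heps; rewrite /= distrC ger0_norm ?subr_ge0 // ltrBlDl.
  lra.
have sl := slope_le_above HT.
have mono : 2^-1 `^ (n - 1) * y 2^-1 <= T `^ (n - 1) * y T.
  have D t : 0 < t -> has_deriv (fun t => t `^ (n - 1) * y t) t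
      (t `^ (n - 1) / t * ((n - 1) * y t - t * w t)).
    move=> t0; apply: has_deriv_eq.
      apply: has_derivM; last exact: y_deriv.
      exact: has_deriv_powR _ t0 (has_deriv_id t).
    by rewrite /= [t `^ (n - 1 - 1)]powRB1 //; field; rewrite gt_eqF.
  apply: (@deriv_ndecr R (fun t => t `^ (n - 1) * y t)
    (fun t => t `^ (n - 1) / t * ((n - 1) * y t - t * w t)) _ _ T2).
  - by move=> t /andP[ht _]; exact: has_deriv_continuous (D t (lt_le_trans h0 ht)).
  - by move=> t /andP[ht _]; exact: D (lt_trans h0 ht).
  - move=> t /andP[ht tT]; have t0 := lt_trans h0 ht.
    by rewrite mulr_ge0 ?divr_ge0 ?powR_ge0 ?(ltW t0) // subr_ge0 sl // t0.
have n1 : 0 <= n - 1 by rewrite subr_ge0.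
(* These two bounds on T `^ (n - 1) * barrier T differ by a factor 2. *)
have low : 2^-1 `^ (n - 1) * 2^-1 <= T `^ (n - 1) * barrier T.
  apply: (@le_trans _ _ (2^-1 `^ (n - 1) * y 2^-1)).
    by rewrite ler_wpM2l ?powR_ge0 // half.
  by apply: le_trans mono _; rewrite ler_wpM2l ?powR_ge0.
have upp : T `^ (n - 1) * barrier T <= 4^-1 * 2^-1 `^ (n - 1).
  rewrite /barrier mulrCA ler_wpM2l ?invr_ge0 //.
  rewrite -[1 - n]opprB powRN ler_pdivrMr ?powR_gt0 // -powRM ?(ltW h0) ?(ltW (base_gt0 _)) //.
  apply: powR_ndecr => //; first exact: ltW.
  by rewrite gtr0_norm //; lra.
have c0 : 0 < (2 : R)^-1 `^ (n - 1) by rewrite powR_gt0.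
lra.
Qed.

(** For q > 0 the bound w <= (kap r)^(1/e) with 1/e > 1 suffices. For q = 0 the
    slope is the flux divided by r^n, the flux is equivalent to kap r^d because the
    source is continuous with value 1 at 0, and kap = 1 / N. *)
Lemma fixpoint_slope_of_cvg : w r / r @[r --> 0^'+] --> y 0 `^ p * 0 `^ q / (n + 1).
Proof.
have y0 : y 0 = 1 by rewrite -yT /picard prim_le0 // subr0.
rewrite y0 powR1 mul1r.
have [q0|qn0] := eqVneq q 0.
  rewrite q0 powRr0; apply/cvgrPdist_lt => eps eps0.
  have e1 : e = 1 by rewrite /e q0 subr0.
  have dE : d = n + 1 by rewrite /d e1 mulr1.
  have sc : {for (0 : R), continuous (source y)} by exact: source_continuous.
  have s0 : source y 0 = 1.
    rewrite /source y0 clamp_id ?powR1 // lexx andbT.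
    by apply: le_trans (barrier_le1 0) _; rewrite invf_le1 // ler1n.
  move: sc => /cvgrPdist_lt/(_ eps eps0); rewrite s0 => -[del /= del0 Hdel].
  exists del => // r /=; rewrite sub0r normrN => rd r0.
  have H1 : kap * (1 - eps) * r `^ d <= flux_of y r.
    apply: flux_of_ge => //; first exact: ltW.
    move=> t /andP[t0 tr]; have := Hdel t; rewrite /= sub0r normrN gtr0_norm //.
    have td : t < del by rewrite (lt_trans tr) // -(gtr0_norm r0).
    by move=> /(_ td); rewrite ltr_norml => /andP[]; lra.
  have H2 := flux_of_le yc (ltW r0).
  have rd0 : 0 < r `^ d by rewrite powR_gt0.
  have wE : w r / r = flux_of y r / r `^ d.
    rewrite /w /slope_of e1 invr1 powRr1 ?flux_of_ge0 // gtr0_norm // dE powRD1 //.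
    by rewrite invfM mulrA.
  have kE : kap = 1 / (n + 1) by rewrite /kap e1 dE.
  have n1 : 0 < n + 1 by rewrite addr_gt0.
  have V1 : flux_of y r / r `^ d <= kap by rewrite ler_pdivrMr.
  have V2 : kap * (1 - eps) <= flux_of y r / r `^ d by rewrite ler_pdivlMr.
  have V3 : kap * eps < eps by rewrite gtr_pMl // kE div1r invf_lt1 // ltrDr.
  rewrite wE -kE; move: V1 V2 V3; rewrite mulrBr mulr1 ltr_norml.
  move: (flux_of y r / r `^ d) (kap * eps) kap => V W k V1 V2 V3.
  by apply/andP; split; lra.
have qp : 0 < q by rewrite lt_neqAle eq_sym qn0.
rewrite powR0 // mul0r.
have eV1 : 0 < e^-1 - 1.
  by rewrite subr_gt0 invf_gt1 // /e gtrBl.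
suff sq : \forall r \near 0^'+, 0 <= w r / r <= r `^ (e^-1 - 1).
  exact: (squeeze_cvgr sq (cvg_cst _) (powR_cvg0 eV1)).
near=> r; have r0 : 0 < r by near: r; exact: nbhs_right_gt.
rewrite divr_ge0 ?slope_of_ge0 ?(ltW r0) //= powRB1 // ler_wpM2r ?invr_ge0 ?(ltW r0) //.
apply: le_trans (slope_of_le yc (ltW r0)) _; apply: powR_ndecr; first exact: ltW.
  by rewrite mulr_ge0 // ltW.
by rewrite ler_piMl // ltW.
Unshelve. all: by end_near. Qed.

Lemma fixpoint_profile :
  [/\ continuous w, w 0 = 0, (forall r, 0 <= r -> 0 < y r),
      (forall r, 0 < r -> 0 < w r)
    & (forall r, 0 < r -> profile_ode p q n y w r)].
Proof.
split.
- exact: slope_of_continuous.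
- exact: slope_of_le0.
- by move=> r r0; apply: y_gt0; rewrite ltW // above_barrier.
- exact: w_gt0.
- by move=> r r0; apply: ode_above => //; rewrite ltW // above_barrier // ltW.
Qed.

End Existence.

(** * The criterion for existence *)

Section Exponents.
Context {R : realType}.
Implicit Types (p q n : R).

(** The condition of the theorem compares p with the critical Sobolev exponent; the
    two forms differ by the positive factor 1 - q. *)
Lemma critical_conditionE p q n : 0 <= p -> q < 1 ->
  ((n * (1 - q) + 1) / (p + 1) <= (n - 1) * (1 - q) / (1 + (1 - q)))
  = (n + 1 + (2 - q) / (1 - q) <= p * (n + 1 - 2) + q * (n + 1 - 1)).
Proof.
move=> p0 q1; have e0 : 0 < 1 - q by rewrite subr_gt0.
have e1 : 0 < 1 + (1 - q) by rewrite addr_gt0.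
have p1 : 0 < p + 1 by rewrite ltr_wpDl.
rewrite ler_pdivrMr // mulrAC ler_pdivlMr //.
rewrite -[in RHS]subr_ge0 -[in LHS]subr_ge0.
rewrite -[in RHS](pmulr_rge0 _ e0).
by congr (_ <= _); field; rewrite gt_eqF.
Qed.

End Exponents.

Section MainResults.
Context {R : realType} {N : nat} (hN : (2 <= N)%N).
Let n : R := N%:R - 1.
Let n_ge1 : 1 <= n. Proof. by rewrite lerBrDr -(natrD _ 1 1) ler_nat. Qed.

Lemma radial_non_constant (f w : R -> R) : 0 < w 1 ->
  has_deriv f 1 (- w 1) -> non_constant (fun x : 'rV[R]_N => f (enorm x)).
Proof.
move=> w1 df [c Hc].
have fc r : 0 < r -> f r = c.
  move=> r0; have := Hc (r *: 'e_(Ordinal (ltnW hN))).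
  by rewrite enorm_axis gtr0_norm.
have H : has_deriv f 1 0.
  apply: (has_deriv_gt0_eq (f := fun=> c)) => //; last exact: has_deriv_cst.
  by move=> t t0; rewrite fc.
by have := has_deriv_unique df H; lra.
Qed.

Lemma radial_solution_exists (p q : R) : 0 <= p -> 0 <= q < 1 ->
  N%:R + (2 - q) / (1 - q) <= p * (N%:R - 2) + q * (N%:R - 1) ->
  exists u : 'rV[R]_N -> R,
    [/\ positive_solution p q u, radial u & non_constant u].
Proof.
move=> p0 /andP[q0 q1]; have NE : N%:R = n + 1 by rewrite subrK.
rewrite NE -critical_conditionE // => crit.
have [y [yc yT]] := picard_fixpoint p0 q0 q1 n_ge1.
have [wc w0 y_gt0 w_gt0 ode] := fixpoint_profile p0 q0 q1 n_ge1 yc yT crit.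
have lim := fixpoint_slope_of_cvg p0 q0 q1 n_ge1 yc yT.
exists (fun x => y (enorm x)); split.
- apply: (@profile_positive_solution R N p q y (slope_of p q n y)) => //.
  + exact: ltnW.
  + move=> t; apply: (@continuous_comp _ _ _ (fun t : R => `|t|) y); last exact: yc.
    exact: norm_continuous.
  + move=> t; apply: (@continuous_comp _ _ _ (fun t : R => `|t|) (slope_of p q n y)); last exact: wc.
    exact: norm_continuous.
  + by move=> r; rewrite le_eqVlt => /predU1P[<-|/w_gt0/ltW//]; rewrite w0.
  + by rewrite NE.
- by exists 0, y => x; rewrite subr0.
- apply: (@radial_non_constant y (slope_of p q n y)); first exact: w_gt0.
  by have [] := ode 1 ltr01.
Qed.

Lemma radial_solution_exponents (p q : R) (u : 'rV[R]_N -> R) :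
  positive_solution p q u -> radial u -> non_constant u ->
  [/\ 0 <= p, 0 <= q < 1 &
      N%:R + (2 - q) / (1 - q) <= p * (N%:R - 2) + q * (N%:R - 1)].
Proof.
move=> [uC2 u_gt0 eqn] [x0 ur] unc.
have NE : N%:R = n + 1 by rewrite subrK.
pose ray r : 'rV[R]_N := r *: 'e_(Ordinal (ltnW hN)) + x0.
pose f r := u (ray r).
pose w r := - 'D_('e_(Ordinal (ltnW hN))) u (ray r).
have f_gt0 r : 0 < f r by exact: u_gt0.
have df r : has_deriv f r (- w r) by exact: (@profile_deriv R N hN u x0 uC2).
have wc : continuous w by exact: (@slope_continuous R N hN u x0 uC2).
have w0 : w 0 = 0 by exact: (@slope_at0 R N hN u x0 uC2 ur).
have lapE r : 0 < r -> - laplacian u (ray r) = f r `^ p * `|w r| `^ q.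
  by move=> r0; rewrite eqn (@gradient_ray R N hN u x0 uC2 ur r r0).
have dw r : 0 < r -> has_deriv w r (f r `^ p * `|w r| `^ q - n * w r / r).
  by move=> r0; rewrite -lapE //; exact: (@slope_deriv R N hN u x0 uC2 ur).
have lapc : continuous (fun r => - laplacian u (ray r)).
  move=> r; apply: (@continuous_opp R R (fun r => laplacian u (ray r))).
  exact: (@laplacian_ray_continuous R N hN u x0 uC2).
have wn0 : exists2 r, 0 < r & w r != 0.
  apply: contrapT => H; apply: unc; exists (f 0) => x.
  rewrite (@radial_profileE R N hN u x0 ur x) -/(f _).
  have w_eq0 r : 0 < r -> w r = 0.
    by move=> r0; apply/eqP; apply: contrapT => /negP wr; apply: H; exists r.
  have fcst r : 0 <= r -> f r = f 0.
    move=> r0; apply/eqP; rewrite -subr_eq0 -normr_le0.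
    have := @deriv_norm_le R f (fun=> 0) (fun=> 0) (fun=> 0) 0 r r0.
    rewrite subrr; apply.
    - by move=> t _; exact: has_deriv_continuous (df t).
    - by move=> t _; exact: continuous_cstE.
    - by move=> t /andP[t0 _]; apply: has_deriv_eq (df t) _; rewrite w_eq0 // oppr0.
    - by move=> t _; exact: has_deriv_cst.
    - by move=> t _; rewrite normr0.
  by apply: fcst; exact: enorm_ge0.
have [r0 [r0_ge0 wr0 w_gt0]] := slope_onset n_ge1 wc w0 dw wn0.
have q0 : 0 <= q := gradient_exponent_ge0 f_gt0 df wc r0_ge0 wr0 w_gt0 lapc lapE.
have q1 : q < 1 := gradient_exponent_lt1 n_ge1 f_gt0 df wc w0 dw r0_ge0 wr0 w_gt0.
have p0 : 0 <= p := source_exponent_ge0 n_ge1 f_gt0 df wc w0 dw r0_ge0 w_gt0 q1.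
split => //; first by rewrite q0.
rewrite NE -critical_conditionE // leNgt; apply/negP => sub.
exact: (no_subcritical_profile n_ge1 f_gt0 df wc w0 dw r0_ge0 wr0 w_gt0 q1 p0 sub).
Qed.

End MainResults.

(** * The explicit family in the critical case *)

Section ExplicitFamily.
Context {R : realType} {N : nat} (p q c K : R).
Hypothesis N_gt0 : (0 < N)%N.
Hypothesis q_ge0 : 0 <= q.
Hypothesis q_lt1 : q < 1.
Hypothesis c_gt0 : 0 < c.
Let m : R := N%:R - 2.
Let k : R := (2 - q) / (1 - q).
Let al : R := (2 - q) ^+ 2 / (m * (1 - q)).
Let bet : R := m * (1 - q) / (2 - q).
Hypothesis m_gt0 : 0 < m.
Hypothesis KE : K = m `^ (q - 1) / (m + k).
Hypothesis critical :
  p * (N%:R - 2) + q * (N%:R - 1) = N%:R + (2 - q) / (1 - q).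

Let e_gt0 : 0 < 1 - q. Proof. by rewrite subr_gt0. Qed.
Let q2_gt0 : 0 < 2 - q. Proof. by rewrite subr_gt0 (lt_trans q_lt1) // ltr1n. Qed.
Let k_gt0 : 0 < k. Proof. exact: divr_gt0. Qed.
Let K_gt0 : 0 < K. Proof. by rewrite KE divr_gt0 ?powR_gt0 // addr_gt0. Qed.
Let NE : N%:R = m + 2. Proof. by rewrite subrK. Qed.
Let pE : p = (m + 2 + k - q * (m + 1)) / m.
Proof.
have := critical; rewrite -/m -/k NE => H.
have {H} : p * m = m + 2 + k - q * (m + 1) by rewrite -H; ring.
by move=> <-; rewrite mulfK // gt_eqF.
Qed.

(** The family of the theorem, written with k = (2 - q) / (1 - q) and
    bet k = N - 2; these are the extremals of the Sobolev inequality attached to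
    the flux equation. *)
Definition bubble_base (t : R) := K * c `^ al + `|t| `^ k.
Definition bubble (t : R) := c * bubble_base t `^ (- bet).
Definition bubble_slope (t : R) :=
  c * m * (`|t| `^ (k - 1) * bubble_base t `^ (- bet - 1)).

Let D0_gt0 : 0 < K * c `^ al. Proof. by rewrite mulr_gt0 ?powR_gt0. Qed.
Let base_gt0 t : 0 < bubble_base t. Proof. by rewrite ltr_wpDr ?powR_ge0. Qed.
Let base_continuous : continuous bubble_base.
Proof.
move=> t; apply: (@continuous_add R R (fun=> K * c `^ al) (fun t => `|t| `^ k)).
  exact: continuous_cstE.
exact: continuous_powR_norm.
Qed.
Let k1_gt0 : 0 < k - 1.
Proof.
by rewrite subr_gt0 ltr_pdivlMr // mul1r ltrD2r ltr1n.
Qed.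

(** The relation between the coefficients: the exponent of D agrees on both sides by
    the critical condition, the exponent of c by the choice of al, and the numerical
    factor by the choice of K. *)
Let amplitude D : 0 < D ->
  c * m * ((m + k) * K * c `^ al * D `^ (- bet - 2))
  = (c * D `^ (- bet)) `^ p * (c * m * D `^ (- bet - 1)) `^ q.
Proof.
move=> D0.
have mk : 0 < m + k by rewrite addr_gt0.
rewrite KE !powRM ?powR_ge0 ?mulr_ge0 ?(ltW c_gt0) ?(ltW m_gt0) //.
rewrite -!powRrM.
have -> : c * m * ((m + k) * (m `^ (q - 1) / (m + k)) * c `^ al * D `^ (- bet - 2))
   = (c `^ al * c) * (m `^ (q - 1) * m) * D `^ (- bet - 2).
  by field; rewrite gt_eqF.
rewrite -!powRD1 // subrK.
have -> : c `^ p * D `^ (- bet * p) * (c `^ q * m `^ q * D `^ ((- bet - 1) * q))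
  = (c `^ p * c `^ q) * m `^ q * (D `^ (- bet * p) * D `^ ((- bet - 1) * q)) by ring.
rewrite -!powRD; try by rewrite ?(gt_eqF c_gt0) ?(gt_eqF D0) implybT.
congr (_ `^ _ * _ * _ `^ _).
  by rewrite pE /al /k; field; rewrite !gt_eqF.
by rewrite pE /bet /k; field; rewrite !gt_eqF.
Qed.

Let bubble_ode r : 0 < r -> profile_ode p q (N%:R - 1) bubble bubble_slope r.
Proof.
move=> r0.
have dD : has_deriv bubble_base r (k * r `^ (k - 1)).
  apply: (has_deriv_gt0_eq (f := fun t => K * c `^ al + t `^ k) r0).
    by move=> t t0; rewrite /bubble_base gtr0_norm.
  apply: has_deriv_eq.
    apply: has_derivD; first exact: has_deriv_cst.
    exact: has_deriv_powR _ r0 (has_deriv_id r).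
  by rewrite /= add0r mulr1.
have bek : bet * k = m by rewrite /bet /k; field; rewrite !gt_eqF.
split.
  apply: has_deriv_eq.
    apply: has_derivZ; exact: has_deriv_powR _ (base_gt0 r) dD.
  by rewrite /bubble_slope (gtr0_norm r0) -bek; ring.
apply: (has_deriv_gt0_eq (f := fun t => c * m * (t `^ (k - 1) * bubble_base t `^ (- bet - 1))) r0).
  by move=> t t0; rewrite /bubble_slope gtr0_norm.
apply: has_deriv_eq.
  apply: has_derivZ; apply: has_derivM.
    exact: has_deriv_powR _ r0 (has_deriv_id r).
  exact: has_deriv_powR _ (base_gt0 r) dD.
rewrite /bubble /bubble_slope (gtr0_norm r0) /=.
have -> : (c * m * (r `^ (k - 1) * bubble_base r `^ (- bet - 1))) `^ q
   = (r `^ (k - 1) / r) * (c * m * bubble_base r `^ (- bet - 1)) `^ q.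
  rewrite mulrCA [LHS]powRM ?powR_ge0 ?mulr_ge0 ?(ltW c_gt0) ?(ltW m_gt0) ?powR_ge0 //.
  congr (_ * _); rewrite -powRrM -powRB1 //; congr (_ `^ _).
  by rewrite /k; field; rewrite gt_eqF.
rewrite [X in _ = X - _]mulrCA -amplitude //.
have E1 : bubble_base r `^ (- bet - 1) = bubble_base r `^ (- bet - 2) * bubble_base r.
  by rewrite -powRD1 //; congr (_ `^ _); ring.
have E2 : - bet - 1 - 1 = - bet - 2 by ring.
rewrite E2 E1 [r `^ (k - 1 - 1)]powRB1 //.
have E3 : K * c `^ al = bubble_base r - r * r `^ (k - 1).
  by rewrite [r * _]mulrC -powRD1 // subrK /bubble_base (gtr0_norm r0) addrK.
have -> : (m + k) * K * c `^ al * bubble_base r `^ (- bet - 2)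
  = (m + k) * (bubble_base r - r * r `^ (k - 1)) * bubble_base r `^ (- bet - 2).
  by rewrite -E3; ring.
rewrite NE; move: (bubble_base r `^ (- bet - 2)) (r `^ (k - 1)) (bubble_base r) => B X D.
have k0 : k != 0 by rewrite gt_eqF.
have -> : m = bet * k by rewrite bek.
by field; rewrite gt_eqF.
Qed.

Lemma bubble_solution : positive_solution p q (fun x : 'rV[R]_N => bubble (enorm x)).
Proof.
have bc : continuous bubble.
  move=> t; apply: (@continuous_mul R R (fun=> c) (fun t => bubble_base t `^ (- bet))).
    exact: continuous_cstE.
  by apply: continuous_powR_gt0 => //; exact: base_continuous.
have sc : continuous bubble_slope.
  move=> t; apply: (@continuous_mul R R (fun=> c * m)
    (fun t => `|t| `^ (k - 1) * bubble_base t `^ (- bet - 1))).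
    exact: continuous_cstE.
  apply: (@continuous_mul R R (fun t => `|t| `^ (k - 1)) (fun t => bubble_base t `^ (- bet - 1))).
    exact: continuous_powR_norm.
  by apply: continuous_powR_gt0 => //; exact: base_continuous.
have norm_comp (g : R -> R) : continuous g -> continuous (fun t : R => g `|t|).
  move=> gc t; apply: (@continuous_comp _ _ _ (fun t : R => `|t|) g); last exact: gc.
  exact: norm_continuous.
apply: (@profile_positive_solution R N p q bubble bubble_slope).
- exact: N_gt0.
- exact: q_ge0.
- exact: norm_comp.
- exact: norm_comp.
- by rewrite /bubble_slope normr0 powR0 ?gt_eqF // mul0r mulr0.
- by move=> r _; rewrite mulr_gt0 ?powR_gt0.
- by move=> r _; rewrite !mulr_ge0 ?powR_ge0 // ltW.
- exact: bubble_ode.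
have k2 : k - 2 = q / (1 - q) by rewrite /k; field; rewrite gt_eqF.
pose g t := c * m * (`|t| `^ (k - 2) * bubble_base t `^ (- bet - 1)).
have gc : continuous g.
  move=> t; apply: (@continuous_mul R R (fun=> c * m)
    (fun t => `|t| `^ (k - 2) * bubble_base t `^ (- bet - 1))).
    exact: continuous_cstE.
  apply: (@continuous_mul R R (fun t => `|t| `^ (k - 2)) (fun t => bubble_base t `^ (- bet - 1))).
    have [q0|qn0] := eqVneq q 0.
      rewrite k2 q0 mul0r (_ : (fun s => _) = fun=> 1); first exact: continuous_cstE.
      by apply/funext => s; rewrite powRr0.
    apply: continuous_powR_norm; rewrite k2 divr_gt0 // lt_neqAle eq_sym qn0.
    exact: q_ge0.
  by apply: continuous_powR_gt0 => //; exact: base_continuous.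
have -> : bubble 0 `^ p * 0 `^ q / N%:R = g 0.
  have D0E : bubble_base 0 = K * c `^ al.
    by rewrite /bubble_base normr0 powR0 ?addr0 // gt_eqF.
  rewrite /g normr0 k2; have [q0|qn0] := eqVneq q 0; last first.
    have qe0 : q / (1 - q) != 0 by rewrite mulf_neq0 // invr_eq0 gt_eqF.
    by rewrite (powR0 qn0) (powR0 qe0) !mul0r !mulr0 mul0r.
  have := amplitude D0_gt0; rewrite -D0E -/(bubble 0) q0 !powRr0 mulr1 => <-.
  rewrite mul0r powRr0 mul1r.
  have -> : bubble_base 0 `^ (- bet - 1) = bubble_base 0 `^ (- bet - 2) * (K * c `^ al).
    by rewrite -D0E -powRD1 //; congr (_ `^ _); ring.
  have -> : k = 2 by rewrite /k q0 !subr0 divr1.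
  have m2 : m + 2 != 0 by rewrite gt_eqF // addr_gt0.
  rewrite NE; move: (bubble_base 0 `^ (- bet - 2)) (c `^ al) m m2 => B C m' m2.
  by field.
apply: (@cvg_trans _ (g @ 0^'+)); last exact: cvg_at_right_filter (@gc 0).
apply: near_eq_cvg; near=> r; have r0 : 0 < r by near: r; exact: nbhs_right_gt.
rewrite /g /bubble_slope (gtr0_norm r0).
have -> : r `^ (k - 2) = r `^ (k - 1) / r.
  by rewrite -powRB1 //; congr (_ `^ _); ring.
by move: (r `^ (k - 1)) (bubble_base r `^ (- bet - 1)) => X B; ring.
Unshelve. all: by end_near. Qed.

End ExplicitFamily.

Local Close Scope classical_set_scope.

Theorem theoremD (R : realType) (N : nat) (hN : (2 <= N)%N) :
  (forall p q : R,
     (exists u : 'rV[R]_N -> R,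
        [/\ positive_solution p q u, radial u & non_constant u])
     <->
     [/\ 0 <= p, 0 <= q < 1 &
         N%:R + (2 - q) / (1 - q) <= p * (N%:R - 2) + q * (N%:R - 1)])
  /\
  (forall q : R, 0 <= q < 1 ->
     exists K : R, 0 < K /\
       forall p : R, 0 <= p ->
         p * (N%:R - 2) + q * (N%:R - 1) = N%:R + (2 - q) / (1 - q) ->
         forall c : R, 0 < c ->
           let u_c (x : 'rV[R]_N) :=
             c * (K * c `^ ((2 - q) ^+ 2 / ((N%:R - 2) * (1 - q)))
                  + enorm x `^ ((2 - q) / (1 - q)))
                 `^ (- ((N%:R - 2) * (1 - q) / (2 - q))) in
           positive_solution p q u_c /\ radial_about 0 u_c).
Proof.
split=> [p q|q /andP[q0 q1]].
  split=> [[u [sol rad nc]]|[p0 q01 crit]].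
    exact: (radial_solution_exponents hN sol rad nc).
  exact: (radial_solution_exists hN p0 q01 crit).
have e0 : 0 < 1 - q by rewrite subr_gt0.
have k0 : 0 < (2 - q) / (1 - q) by rewrite divr_gt0 // subr_gt0 (lt_trans q1) // ltr1n.
have [N2|N2] := leqP N 2.
  have NE : N = 2%N by apply/eqP; rewrite eqn_leq N2.
  exists 1; split => // p p0; rewrite NE subrr mulr0 add0r => crit.
  have : q * (2 - 1) < 2 + (2 - q) / (1 - q) by lra.
  by rewrite crit ltxx.
have m0 : 0 < N%:R - 2 :> R by rewrite subr_gt0 ltr_nat.
exists ((N%:R - 2) `^ (q - 1) / (N%:R - 2 + (2 - q) / (1 - q))); split.
  by rewrite divr_gt0 ?powR_gt0 // addr_gt0.
move=> p p0 crit c c0 u_c.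
set K := (N%:R - 2) `^ (q - 1) / _ in u_c *.
have -> : u_c = fun x : 'rV[R]_N => bubble (N := N) q c K (enorm x).
  by apply/funext => x; rewrite /u_c /bubble /bubble_base ger0_norm // enorm_ge0.
split; last by exists (bubble (N := N) q c K) => x; rewrite subr0.
exact: (bubble_solution (ltnW hN) q0 q1 c0 m0 erefl crit).
Qed.
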